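(* Let $M$ be any von Neumann algebra with a faithful normal state $\varphi$. Let $N \subset M$ be any von Neumann subalgebra and let $\Sigma = J\Sigma \subset L^2(M)$ be any self-adjoint subset consisting of $\varphi$-bounded elements. Suppose that for every bounded net $(x_i)_{i \in I}$ in $N$ which satisfies $\lim_i \|x_i \xi - \xi x_i\| = 0$ for all $\xi \in \Sigma$, we have $\lim_i \|x_i - \varphi(x_i)\|_\varphi = 0$. Then there exist a non-zero projection $p \in N$, a finite subset $S \subset \Sigma$ and a constant $\kappa > 0$ such that for every $x \in pNp$ with $\varphi(x) = 0$ we have $$\|x\|_\varphi \leq \kappa \sum_{\xi \in S} \| p(x\xi - \xi x)p \| .$$ Moreover, $p$ can be chosen arbitrarily close to $1$, i.e. for every $\varepsilon>0$ one can find such $p, S, \kappa$ with $\varphi(1-p) < \varepsilon$.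
   Context: $L^2(M)$ denotes the standard form of $M$, with modular conjugation $J$; it is an $M$-$M$-bimodule, with left action $x\xi$ and right action $\xi x := Jx^*J\xi$. For a faithful normal state $\varphi$ on $M$, $\xi_\varphi \in L^2(M)$ is the cyclic vector associated to $\varphi$ (the unique vector in the positive cone of $L^2(M)$ with $\varphi(x) = \langle x\xi_\varphi, \xi_\varphi\rangle$ for all $x\in M$), and $\|x\|_\varphi = \varphi(x^*x)^{1/2} = \|x\xi_\varphi\|$. A vector $\xi \in L^2(M)$ is called $\varphi$-bounded if $\xi \in M\xi_\varphi$. A bounded net means bounded in operator norm. Scalars are identified with multiples of the unit $1 \in M$. As usual, a von Neumann subalgebra of $M$ contains the unit of $M$. *)

(* Defs.v *)
From HB Require Import structures.
From mathcomp Require Import all_boot all_order all_algebra.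
From mathcomp Require Import finmap.
From mathcomp Require Import all_classical all_reals all_analysis.
From mathcomp Require Import sesquilinear.
From mathcomp.real_closed Require Import complex.

Set Implicit Arguments.
Unset Strict Implicit.
Unset Printing Implicit Defensive.

Import Order.TTheory GRing.Theory Num.Theory.
Import numFieldNormedType.Exports.

Local Open Scope classical_set_scope.
Local Open Scope complex_scope.
Local Open Scope ring_scope.

(* The inner product is linear in its first argument. *)
HB.mixin Record isHilbert (R : realType) H & CompleteNormedModule R[i] H := {
  inner : {dot H for (@Num.conj R[i])} ;
  inner_norm : forall u : H, `|u| ^+ 2 = inner u u
}.

#[short(type="hilbertType")]
HB.structure Definition Hilbert (R : realType) :=
  { H of isHilbert R H & CompleteNormedModule R[i] H }.

Notation "''[' u , v ]" := (inner u v) (format "''[' u ,  v ]") : ring_scope.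

Section Operators.
Context {R : realType} {H : hilbertType R}.
Implicit Types (A M : set (H -> H)) (x y p : H -> H).

Definition bounded_op : set (H -> H) := [set x | linear x /\ continuous x].

Definition is_adjoint x y := forall u v, '[x u, v] = '[u, y v].

(* x^*; it is uniquely determined by is_adjoint x, and xget only supplies a
   junk value for the functions x without an adjoint. *)
Definition adj x : H -> H := xget 0 (is_adjoint x).

Definition commutant A : set (H -> H) :=
  [set y | bounded_op y /\ forall x, A x -> x \o y = y \o x].

(* A commutant consists of bounded operators and is a unital algebra, so the
   bicommutant condition makes M a unital *-subalgebra of B(H). *)
Record von_neumann_algebra M : Prop := {
  vna_adj : forall x, M x -> exists2 y, M y & is_adjoint x y ;
  vna_bicommutant : commutant (commutant M) = M
}.

Definition positive x := forall u, 0 <= '[x u, u].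

Definition op_le x y := positive (y - x).

Definition is_projection p := p \o p = p /\ is_adjoint p p.

End Operators.

Section Nets.
Variables (I : Type) (le : I -> I -> Prop).

Record directed : Prop := {
  directed_inhabited : inhabited I ;
  directed_refl : forall i, le i i ;
  directed_trans : forall j i k, le i j -> le j k -> le i k ;
  directed_ub : forall i j, exists2 k, le i k & le j k
}.

(* f @ tails --> l is the convergence to l of the net f. *)
Definition tails : set_system I :=
  [set A | exists i, [set j | le i j] `<=` A].

End Nets.

Section States.
Context {R : realType} {K : hilbertType R}.
Variables (M : set (K -> K)) (phi : (K -> K) -> R[i]).
Implicit Types x y z : K -> K.

(* y is the supremum in M of the net x *)
Definition is_sup (I : Type) (x : I -> K -> K) y :=
  [/\ M y, forall i, op_le (x i) y &
      forall z, M z -> (forall i, op_le (x i) z) -> op_le y z].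

Definition normal_functional :=
  forall (I : Type) (le : I -> I -> Prop) (x : I -> K -> K) y,
    directed le ->
    (forall i, M (x i) /\ positive (x i)) ->
    (forall i j, le i j -> op_le (x i) (x j)) ->
    is_sup x y ->
    (fun i => phi (x i)) @ tails le --> (phi y : R[i]^o).

(* The values of phi outside M are irrelevant. *)
Record faithful_normal_state : Prop := {
  state_linear : forall (a : R[i]) x y, M x -> M y ->
    phi (a *: x + y) = a * phi x + phi y ;
  state_ge0 : forall x, M x -> positive x -> 0 <= phi x ;
  state1 : phi idfun = 1 ;
  state_faithful : forall x, M x -> phi (adj x \o x) = 0 -> x = 0 ;
  state_normal : normal_functional
}.

Definition state_norm x : R[i] := sqrtC (phi (adj x \o x)).

End States.

(* Haagerup's standard form of a von Neumann algebra M on K, carried by the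
   Hilbert space L = L^2(M): rho is the left action of M on L, J the modular
   conjugation and P the positive cone. Haagerup's axioms determine
   (L, rho, J, P) up to a unique unitary. *)
Section StandardForm.
Context {R : realType} {K L : hilbertType R}.
Variables (M : set (K -> K)) (rho : (K -> K) -> L -> L) (J : L -> L).
Variable P : set L.
Implicit Types x y : K -> K.

(* The values of rho outside M are irrelevant. *)
Record star_isomorphism : Prop := {
  siso_linear : forall (a : R[i]) x y, M x -> M y ->
    rho (a *: x + y) = a *: rho x + rho y ;
  siso_mul : forall x y, M x -> M y -> rho (x \o y) = rho x \o rho y ;
  siso_adj : forall x y, M x -> M y -> is_adjoint x y ->
    is_adjoint (rho x) (rho y) ;
  siso_inj : forall x y, M x -> M y -> rho x = rho y -> x = y ;
  siso_image : von_neumann_algebra (rho @` M)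
}.

Record standard_form : Prop := {
  std_iso : star_isomorphism ;
  std_J_antilinear : forall (a : R[i]) (u v : L),
    J (a *: u + v) = a^* *: J u + J v ;
  std_J_isometry : forall u v : L, '[J u, J v] = '[v, u] ;
  std_J_involutive : forall u, J (J u) = u ;
  std_selfdual : P = [set u | forall v, P v -> 0 <= '[u, v]] ;
  std_JMJ : [set J \o z \o J | z in rho @` M] = commutant (rho @` M) ;
  std_center : forall z, (rho @` M) z -> commutant (rho @` M) z ->
    is_adjoint z (J \o z \o J) ;
  std_fix : forall u, P u -> J u = u ;
  std_cone : forall z u, (rho @` M) z -> P u -> P (z (J (z (J u))))
}.

Definition lact x (xi : L) : L := rho x xi.

Definition ract (xi : L) x : L := J (rho (adj x) (J xi)).

(* xi is the cyclic vector of the state phi *)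
Definition state_vector (phi : (K -> K) -> R[i]) (xi : L) :=
  P xi /\ forall x, M x -> phi x = '[lact x xi, xi].

Definition phi_bounded (xiphi xi : L) := exists2 x, M x & xi = lact x xiphi.

End StandardForm.

Section SpectralGap.
Context {R : realType} {K L : hilbertType R}.
Variables (rho : (K -> K) -> L -> L) (J : L -> L).
Variables (phi : (K -> K) -> R[i]) (N : set (K -> K)) (Sigma : set L).

Definition bounded_net (I : Type) (x : I -> K -> K) :=
  exists c : R, forall i u, `|x i u| <= c%:C * `|u|.

Definition commutator x (xi : L) : L := lact rho x xi - ract rho J xi x.

Definition asymptotically_scalar :=
  forall (I : Type) (le : I -> I -> Prop) (x : I -> K -> K),
    directed le ->
    (forall i, N (x i)) ->
    bounded_net x ->
    (forall xi, Sigma xi ->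
      (fun i => `|commutator (x i) xi|) @ tails le --> (0 : R[i]^o)) ->
    (fun i => state_norm phi (x i - phi (x i) *: idfun)) @ tails le
      --> (0 : R[i]^o).

Record corner_gap (p : K -> K) (S : {fset L}) (kappa : R) : Prop := {
  gap_in : N p ;
  gap_projection : is_projection p ;
  gap_neq0 : p <> 0 ;
  gap_sub : [set` S] `<=` Sigma ;
  gap_kappa : 0 < kappa ;
  gap_ineq : forall x, (exists2 y, N y & x = p \o y \o p) -> phi x = 0 ->
    state_norm phi x <=
    kappa%:C * \sum_(xi <- S) `|ract rho J (lact rho p (commutator x xi)) p|
}.

End SpectralGap.

(* Main.v *)
Require Import Defs.
From HB Require Import structures.
From mathcomp Require Import all_boot all_order all_algebra.
From mathcomp Require Import finmap.
From mathcomp Require Import all_classical all_reals all_analysis.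
From mathcomp.real_closed Require Import complex.
From mathcomp Require Import sesquilinear ring lra.
Import Order.TTheory GRing.Theory Num.Theory.
Import numFieldNormedType.Exports.
Local Open Scope classical_set_scope.
Local Open Scope complex_scope.
Local Open Scope ring_scope.

(** Fix a finite J-stable subset S of Sigma and call energy of x the sum of
    |x xi - xi x|^2 over xi in S.  Suppose that there is no gap on any corner
    pNp with phi(1 - p) < eps, for any such S.  The proof constructs, for all S
    and delta > 0, a projection Q in N of energy at most delta whose mass phi(Q)
    lies between eps and (1 + eps)/2.  These projections, indexed by S and by
    delta = 1/(n+1), form a bounded net which asymptotically commutes with Sigma,
    while |Q - phi(Q)|_phi^2 = phi(Q)(1 - phi(Q)) stays away from 0.  This
    contradicts the hypothesis.

    The projection Q is assembled from small pieces.  Let Q have energy at most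
    delta phi(Q) and phi(Q) < eps.  The corner of p = 1 - Q has no gap, and this
    produces a non-zero projection q in pNp with phi(q) <= phi(p)/2 and corner
    energy at most delta phi(q) ([sparse_corner_projection]).  In the
    decomposition of xi along Q, q and 1 - Q - q the energy of Q + q is at most
    the energy of Q plus the corner energy of q ([energy_extend]), so Q + q
    again has energy at most delta times its mass.  Normality of the state makes
    this class of projections stable under increasing limits
    ([projection_sup]), and an ascent argument ([maximal_element]) shows that
    some step must cross eps ([small_commutator_projection]).

    The piece q comes from a self-adjoint h in pNp with phi(h) = 0 and small
    commutators relative to |h|_phi; its operator norm is not controlled.  As in
    Connes' work on injective factors, q is a spectral projection of h.  Both
    actions of self-adjoint elements of M on a vector xi of Sigma are bounded by
    a multiple of |.|_phi ([bounded_vector]), so h may be replaced by a step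
    operator, a combination of orthogonal projections r_i with equally spaced
    coefficients ([spectral_steps]).  The components r_i xi r_j are pairwise
    orthogonal, and the problem becomes one about the masses phi(r_i) and the
    weights |r_i xi r_j|^2: small energy of the function i -> i compared with its
    variance forces a level set with small boundary ([sparse_cut]).  Centering
    at a median bounds the mass of the level set by one half.

    The spectral projections are built by hand from strong limits: the modulus
    |h| as the limit of an iteration ([op_abs]), then the projection onto the
    kernel of |h| - h as a limit of powers ([kernel_projection]). *)

Set Implicit Arguments.
Unset Strict Implicit.
Unset Printing Implicit Defensive.

(** * The underlying real Hilbert space and strong limits *)

Section RealInnerProduct.
Context {R : realType} {H : hilbertType R}.
Implicit Types (u v w : H) (x y : H -> H).

(** All estimates only involve this real form.  It is invariant under the
    antilinear J, and for a self-adjoint x the number ip (x u) u is the whole of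
    the inner product. *)
Definition ip u v : R := complex.Re '[u, v].

Definition sqn u : R := ip u u.

Lemma ReD (a b : R[i]) : complex.Re (a + b) = complex.Re a + complex.Re b.
Proof. by case: a => ? ?; case: b. Qed.

Lemma ReMr (c : R) (a : R[i]) : complex.Re (c%:C * a) = c * complex.Re a.
Proof. by case: a => p q /=; rewrite mul0r subr0. Qed.

Lemma innerC u v : '[u, v] = (Num.conj '[v, u]).
Proof. by rewrite (hermC inner u v) expr0 mul1r. Qed.

Lemma ipC u v : ip u v = ip v u.
Proof. by rewrite /ip innerC; case: '[v, u]. Qed.

Lemma ipDl w : {morph ip^~ w : u v / u + v}.
Proof. by move=> u v; rewrite /ip linearDl ReD. Qed.

Lemma ipZl (c : R) u w : ip (c%:C *: u) w = c * ip u w.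
Proof. by rewrite /ip linearZl_LR ReMr. Qed.

Lemma ipDr w : {morph ip w : u v / u + v}.
Proof. by move=> u v; rewrite ipC ipDl !(ipC _ w). Qed.

Lemma ipZr (c : R) u w : ip u (c%:C *: w) = c * ip u w.
Proof. by rewrite ipC ipZl ipC. Qed.

Lemma ipNl u v : ip (- u) v = - ip u v.
Proof. by rewrite -scaleN1r -(mulN1r (ip u v)) -ipZl rmorphN. Qed.

Lemma ipNr u v : ip u (- v) = - ip u v.
Proof. by rewrite ipC ipNl ipC. Qed.

Lemma ip0l u : ip 0 u = 0.
Proof. by rewrite -(scale0r u) ipZl mul0r. Qed.

Lemma ip0r u : ip u 0 = 0.
Proof. by rewrite ipC ip0l. Qed.

Lemma ipBl u v w : ip (u - v) w = ip u w - ip v w.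
Proof. by rewrite ipDl ipNl. Qed.

Lemma ipBr u v w : ip w (u - v) = ip w u - ip w v.
Proof. by rewrite ipDr ipNr. Qed.

Lemma ip_suml (I : Type) (r : seq I) (Q : pred I) (F : I -> H) w :
  ip (\sum_(i <- r | Q i) F i) w = \sum_(i <- r | Q i) ip (F i) w.
Proof. exact: (big_morph (ip^~ w) (ipDl w) (ip0l w)). Qed.

Lemma ip_sumr (I : Type) (r : seq I) (Q : pred I) (F : I -> H) w :
  ip w (\sum_(i <- r | Q i) F i) = \sum_(i <- r | Q i) ip w (F i).
Proof. exact: (big_morph (ip w) (ipDr w) (ip0r w)). Qed.

Lemma norm_real u : `|u| = (complex.Re `|u|)%:C.
Proof. by rewrite RRe_real// normr_real. Qed.

Lemma Re_norm_ge0 u : 0 <= complex.Re `|u|.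
Proof. by rewrite -ler0c -norm_real. Qed.

Lemma sqnE u : sqn u = (complex.Re `|u|) ^+ 2.
Proof. by rewrite /sqn /ip -inner_norm norm_real -rmorphXn. Qed.

Lemma inner_sqn u : '[u, u] = (sqn u)%:C.
Proof. by rewrite -inner_norm norm_real sqnE -rmorphXn. Qed.

Lemma sqn_ge0 u : 0 <= sqn u.
Proof. by rewrite sqnE sqr_ge0. Qed.

Lemma sqn0 : sqn 0 = 0.
Proof. exact: ip0l. Qed.

Lemma sqn_eq0 u : sqn u = 0 -> u = 0.
Proof.
move=> /eqP; rewrite sqnE sqrf_eq0 => /eqP u0.
by apply/normr0_eq0; rewrite norm_real u0.
Qed.

Lemma sqnD u v : sqn (u + v) = sqn u + 2 * ip u v + sqn v.
Proof. by rewrite /sqn ipDl !ipDr (ipC v u); ring. Qed.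

Lemma sqnB u v : sqn (u - v) = sqn u - 2 * ip u v + sqn v.
Proof. by rewrite /sqn ipBl !ipBr (ipC v u); ring. Qed.

Lemma sqnN u : sqn (- u) = sqn u.
Proof. by rewrite /sqn ipNl ipNr opprK. Qed.

Lemma sqnZ (c : R) u : sqn (c%:C *: u) = c ^+ 2 * sqn u.
Proof. by rewrite /sqn ipZl ipZr mulrA expr2. Qed.

Lemma sqnD_le u v : sqn (u + v) <= 2 * sqn u + 2 * sqn v.
Proof. by have := sqn_ge0 (u - v); rewrite sqnB sqnD; lra. Qed.

Lemma sqnB_le u v : sqn (u - v) <= 2 * sqn u + 2 * sqn v.
Proof. by have := sqnD_le u (- v); rewrite sqnN. Qed.

Lemma sqnB_le_weighted u v (t : R) : 0 < t ->
  sqn (u - v) <= (1 + t) * sqn u + (1 + t^-1) * sqn v.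
Proof.
move=> t0; have := sqn_ge0 (t%:C *: u + v); rewrite (sqnD (t%:C *: u)) sqnZ ipZl => h.
rewrite sqnB -subr_ge0.
have -> : (1 + t) * sqn u + (1 + t^-1) * sqn v - (sqn u - 2 * ip u v + sqn v) =
    t^-1 * (t ^+ 2 * sqn u + 2 * (t * ip u v) + sqn v).
  by field; rewrite gt_eqF.
by rewrite mulr_ge0// invr_ge0 ltW.
Qed.

Lemma ip_le u v : 2 * ip u v <= sqn u + sqn v.
Proof. by have := sqn_ge0 (u - v); rewrite sqnB; lra. Qed.

Lemma cauchy_schwarz u v : ip u v ^+ 2 <= sqn u * sqn v.
Proof.
have [v0|v0] := eqVneq (sqn v) 0.
  by rewrite (sqn_eq0 v0) ip0r sqn0 mulr0 expr0n.
have vp : 0 < sqn v by rewrite lt_neqAle eq_sym v0 sqn_ge0.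
have := sqn_ge0 ((sqn v)%:C *: u - (ip u v)%:C *: v).
rewrite sqnB !sqnZ ipZl ipZr => h.
rewrite -(ler_pM2l vp) -subr_ge0; apply: le_trans h _.
by rewrite le_eqVlt; apply/orP; left; apply/eqP; ring.
Qed.

Lemma ip_adjoint x y : is_adjoint x y -> forall u v, ip (x u) v = ip u (y v).
Proof. by move=> xy u v; rewrite /ip xy. Qed.

Lemma linD x u v : linear x -> x (u + v) = x u + x v.
Proof. by move=> lx; rewrite -[u]scale1r lx !scale1r. Qed.

Lemma lin0 x : linear x -> x 0 = 0.
Proof.
by move=> lx; apply: (addrI (x 0)); rewrite -linD// !addr0.
Qed.

Lemma linZ x a u : linear x -> x (a *: u) = a *: x u.
Proof. by move=> lx; rewrite -[a *: u]addr0 lx lin0// addr0. Qed.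

Lemma linN x u : linear x -> x (- u) = - x u.
Proof. by move=> lx; rewrite -scaleN1r linZ// scaleN1r. Qed.

Lemma linB x u v : linear x -> x (u - v) = x u - x v.
Proof. by move=> lx; rewrite linD// linN. Qed.

Lemma lin_sum x (I : Type) (r : seq I) (Q : pred I) (F : I -> H) :
  linear x -> x (\sum_(i <- r | Q i) F i) = \sum_(i <- r | Q i) x (F i).
Proof.
move=> lx; apply: (big_morph x) => [u v|]; first exact: linD.
exact: lin0.
Qed.

(** The real part of the inner product determines the whole of it, because
    the imaginary part is the real part at a rotated vector. *)
Lemma adjoint_of_ip x y : linear x -> linear y ->
  (forall u v, ip (x u) v = ip u (y v)) -> is_adjoint x y.
Proof.
move=> lx ly h u v.
have Im_ip (a b : H) : complex.Im '[a, b] = - ip ('i%C *: a) b.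
  rewrite /ip linearZl_LR /=; case: '[a, b] => p q /=. by ring.
have := h u v; have := h ('i%C *: u) v.
rewrite (linZ _ _ lx) => h1 h2.
apply/eqP; rewrite eq_complex; apply/andP; split; apply/eqP; first exact: h2.
by rewrite !Im_ip h1.
Qed.

(** The constant comes from a ball around 0 that x maps into the unit ball. *)
Lemma bounded_opP x : bounded_op x ->
  exists2 c : R, 0 < c & forall u, sqn (x u) <= c * sqn u.
Proof.
move=> [lx cx].
have /nbhs_ballP [e /= e0 he] : nbhs (0 : H) (x @^-1` ball (x 0) 1).
  by apply: cx; apply: nbhsx_ballx; exact: ltr01.
have er : e = (complex.Re e)%:C by rewrite RRe_real// gtr0_real.
set e' := complex.Re e in er.
have e'0 : 0 < e' by move: e0; rewrite er ltcR.
exists (4 / e' ^+ 2).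
  by rewrite divr_gt0// ?exprn_gt0//; lra.
move=> u.
have [u0|u0] := eqVneq (sqn u) 0.
  by rewrite (sqn_eq0 u0) lin0// sqn0 mulr0.
have up : 0 < sqn u by rewrite lt_neqAle eq_sym u0 sqn_ge0.
have np : 0 < complex.Re `|u|.
  rewrite lt_neqAle Re_norm_ge0 andbT eq_sym.
  by apply: contra_neq u0; rewrite sqnE => ->; rewrite expr0n.
set n := complex.Re `|u| in np.
(* t u has norm e'/2, inside the ball of radius e' *)
pose t := e' / (2 * n).
have tp : 0 < t by rewrite divr_gt0//; lra.
have : ball (x 0) 1 (x (t%:C *: u)).
  apply: he; rewrite -ball_normE /ball_ /= sub0r normrN normrZ.
  rewrite norm_real er -/n ger0_norm ?ler0c ?ltW// -rmorphM ltcR.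
  rewrite /t; have -> : e' / (2 * n) * n = e' / 2 by field; rewrite ?lt0r_neq0.
  by lra.
rewrite -ball_normE /ball_ /= lin0// sub0r normrN norm_real.
rewrite -[1]/(1%:C) ltcR => h.
have : sqn (x (t%:C *: u)) <= 1.
  rewrite sqnE -[leRHS](expr1n _ 2); apply: lerXn2r; rewrite ?nnegrE ?ler01//.
    exact: Re_norm_ge0.
  exact: ltW.
rewrite linZ// sqnZ => h2.
have t2 : 0 < t ^+ 2 by rewrite exprn_gt0.
rewrite -(ler_pM2l t2); apply: le_trans h2 _.
rewrite le_eqVlt; apply/orP; left; apply/eqP; rewrite sqnE -/n /t.
by field; rewrite ?lt0r_neq0// gt_eqF.
Qed.

Lemma bounded_op_of_sqn x (c : R) : linear x ->
  (forall u, sqn (x u) <= c * sqn u) -> bounded_op x.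
Proof.
move=> lx hx; split=> //.
pose X : {linear H -> H} :=
  HB.pack x (GRing.isLinear.Build R[i] H H *:%R x lx).
suff : continuous X by [].
apply/linear_bounded_continuous/linear_boundedP.
have c0 : c <= Num.max c 0 by rewrite le_max lexx.
have c1 : 0 <= Num.max c 0 by rewrite le_max lexx orbT.
set d := Num.max c 0 in c0 c1.
near=> M => u.
have Mr : (d + 1)%:C <= M.
  by near: M; apply: nbhs_pinfty_ge; rewrite gtr0_real// ltcR; lra.
apply: le_trans (_ : (d + 1)%:C * `|u| <= _); last first.
  by rewrite ler_wpM2r.
rewrite norm_real (norm_real u) -rmorphM lecR.
have d1 : 0 <= d + 1 by lra.
rewrite -(@ler_pXn2r _ 2)// ?nnegrE ?mulr_ge0 ?Re_norm_ge0//.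
rewrite exprMn -!sqnE; apply: le_trans (hx u) _.
apply: ler_wpM2r; first exact: sqn_ge0.
by nra.
Unshelve. all: by end_near. Qed.

Lemma cvg_sqnP (a : nat -> H) (l : H) : a @ \oo --> l <->
  forall e : R, 0 < e -> exists n0, forall n, (n0 <= n)%N -> sqn (a n - l) < e.
Proof.
split=> [al e e0|h].
  have s0 : 0 < Num.sqrt e by rewrite sqrtr_gt0.
  have /cvgrPdistC_lt/(_ (Num.sqrt e)%:C) := al.
  rewrite ltcR => /(_ s0) [n0 _ hn0].
  exists n0 => n n0n; have /= := hn0 _ n0n.
  rewrite norm_real ltcR => h; rewrite sqnE -(sqr_sqrtr (ltW e0)).
  by rewrite ltrXn2r// ?Re_norm_ge0// ltW.
apply/cvgrPdistC_lt => e e0.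
have er : e = (complex.Re e)%:C by rewrite RRe_real// gtr0_real.
have e'0 : 0 < complex.Re e by move: e0; rewrite er ltcR.
have [n0 hn0] := h (complex.Re e ^+ 2) (exprn_gt0 _ e'0).
exists n0 => // n /= /hn0; rewrite sqnE norm_real er ltcR.
by rewrite ltr_pXn2r// ?nnegrE ?Re_norm_ge0// ltW.
Qed.

Lemma cauchy_sqn_cvg (a : nat -> H) (f : nat -> R) (c : R) :
  (forall m n, (n <= m)%N -> sqn (a m - a n) <= f m - f n) ->
  (forall n, f n <= c) -> exists l : H, a @ \oo --> l.
Proof.
move=> haf fc.
have ndf : {homo f : n m / (n <= m)%N >-> n <= m}.
  by move=> n m nm; have := haf m n nm; have := sqn_ge0 (a m - a n); lra.
have /nondecreasing_is_cvgn -/(_ _)/cvg_ex[|l fl] := ndf.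
  by exists c => _ [n _ <-].
suff : cvg (a @ \oo) by move=> /cvg_ex.
apply: cauchy_cvg; apply: cauchy_exP => e e0.
have er : e = (complex.Re e)%:C by rewrite RRe_real// gtr0_real.
have e'0 : 0 < complex.Re e by move: e0; rewrite er ltcR.
have /cvgrPdistC_lt/(_ _ (exprn_gt0 2 e'0)) [n0 _ hn0] := fl.
exists (a n0); exists n0 => // m /= n0m.
rewrite -ball_normE /ball_ /= distrC norm_real er ltcR.
rewrite -(@ltr_pXn2r _ 2)// ?nnegrE ?Re_norm_ge0//; last exact: ltW.
rewrite -sqnE; apply: le_lt_trans (haf _ _ n0m) _.
have := hn0 n0 (leqnn _); rewrite /= => h.
have fml k : f k <= l.
  have -> : l = limn f by apply/esym/cvg_lim.
  apply: nondecreasing_cvgn_le => //.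
  by apply/cvg_ex; exists l.
have := fml m; move: h; rewrite ltr_norml => /andP[h _].
by lra.
Qed.

Lemma cvg_ip (a : nat -> H) (l v : H) : a @ \oo --> l ->
  (fun n => ip (a n) v) @ \oo --> ip l v.
Proof.
move=> /cvg_sqnP al; apply/cvgrPdistC_lt => e e0.
have d0 : 0 < sqn v + 1 by have := sqn_ge0 v; lra.
have [n0 hn0] := al (e ^+ 2 / (sqn v + 1)) (divr_gt0 (exprn_gt0 2 e0) d0).
exists n0 => // n /= /hn0 h.
rewrite -ipBl -(@ltr_pXn2r _ 2)// ?nnegrE ?normr_ge0 ?ltW//.
rewrite real_normK ?num_real//; apply: le_lt_trans (cauchy_schwarz _ _) _.
move: h; rewrite ltr_pdivlMr// => h.
by have := sqn_ge0 (a n - l); have := sqn_ge0 v; nra.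
Qed.

Lemma cvg_sqn (a : nat -> H) (l : H) : a @ \oo --> l ->
  (fun n => sqn (a n)) @ \oo --> sqn l.
Proof.
move=> al.
have -> : (fun n => sqn (a n)) =
    (fun n => sqn (a n - l) + (2 * ip (a n) l - sqn l)).
  by apply/funext => n; rewrite sqnB; ring.
suff h : (fun n => sqn (a n - l) + (2 * ip (a n) l - sqn l)) @ \oo -->
    0 + (2 * ip l l - sqn l).
  by move: h; rewrite /sqn; have -> : 0 + (2 * ip l l - ip l l) = ip l l by ring.
apply: cvgD.
  move/cvg_sqnP: al => al.
  apply/cvgrPdistC_lt => e /al[n0 hn0]; exists n0 => // n /= /hn0.
  by rewrite subr0 ger0_norm ?sqn_ge0.
apply: cvgB; last exact: cvg_cst.
by apply: cvgMl_tmp; exact: cvg_ip.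
Qed.

(** Strong limits stay inside every commutant because its defining relations
    only involve continuous operators.  The bounded functions f are monotone
    and express that monotone sequences of operators are Cauchy at each vector. *)
Lemma strong_limit (B : set (H -> H)) (x : nat -> H -> H) :
  (forall b, B b -> bounded_op b) ->
  (forall n, commutant B (x n)) ->
  (forall n u, sqn (x n u) <= sqn u) ->
  (forall n, is_adjoint (x n) (x n)) ->
  (forall u, exists (f : nat -> R) (c : R),
     (forall m n, (n <= m)%N -> sqn (x m u - x n u) <= f m - f n) /\
     (forall n, f n <= c)) ->
  exists X : H -> H, [/\ commutant B X, forall u, sqn (X u) <= sqn u,
    is_adjoint X X & forall u, (fun n => x n u) @ \oo --> X u].
Proof.
move=> hB hx x1 xa xc.
have /choice[X hX] : forall u, exists l : H, (fun n => x n u) @ \oo --> l.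
  by move=> u; have [f [c [h1 h2]]] := xc u; exact: cauchy_sqn_cvg h1 h2.
have lx n : linear (x n) by case: (hx n) => -[].
have lX : linear X.
  move=> a u v.
  have h : (fun n => x n (a *: u + v)) @ \oo --> a *: X u + X v.
    have -> : (fun n => x n (a *: u + v)) = (fun n => a *: x n u + x n v).
      by apply/funext => n; rewrite lx.
    by apply: cvgD => //; apply: cvgZr.
  exact: norm_cvg_unique (hX _) h.
have X1 u : sqn (X u) <= sqn u.
  apply: (ler_cvg_to (cvg_sqn (hX u)) (cvg_cst (sqn u))).
  by apply: nearW => n; exact: x1.
exists X; split=> //.
  split; first by apply: (@bounded_op_of_sqn _ 1) => // u; rewrite mul1r.
  move=> b Bb; apply/funext => u /=.
  have h : (fun n => x n (b u)) @ \oo --> b (X u).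
    have -> : (fun n => x n (b u)) = (fun n => b (x n u)).
      by apply/funext => n; have [_ /(_ _ Bb)/(congr1 (@^~ u))] := hx n.
    have [_ cb] := hB _ Bb.
    by apply: continuous_cvg => //; exact: cb.
  exact: norm_cvg_unique h (hX _).
apply: adjoint_of_ip => // u v.
have h : (fun n => ip (x n u) v) @ \oo --> ip u (X v).
  have -> : (fun n => ip (x n u) v) = (fun n => ip (x n v) u).
    by apply/funext => n; rewrite (ip_adjoint (xa n)) ipC.
  by rewrite ipC; exact: cvg_ip.
exact: norm_cvg_unique (cvg_ip (hX u)) h.
Qed.

End RealInnerProduct.

(** * Adjoints, commutants and the modulus of an operator *)

Section Commutants.
Context {R : realType} {H : hilbertType R}.
Implicit Types (u v w : H) (x y h : H -> H).

Lemma opDE x y u : (x + y) u = x u + y u. Proof. by []. Qed.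

Lemma opZE (a : R[i]) x u : (a *: x) u = a *: x u. Proof. by []. Qed.

Lemma opBE x y u : (x - y) u = x u - y u. Proof. by []. Qed.

Lemma op_sumE (I : Type) (r : seq I) (Q : pred I) (F : I -> H -> H) u :
  (\sum_(i <- r | Q i) F i) u = \sum_(i <- r | Q i) F i u.
Proof. by elim/big_rec2: _ => // i x y _ <-. Qed.

Lemma is_adjoint_sym x y : is_adjoint x y -> is_adjoint y x.
Proof. by move=> xy u v; rewrite innerC -xy -innerC. Qed.

Lemma is_adjoint_id : is_adjoint (@idfun H) idfun.
Proof. by []. Qed.

Lemma is_adjoint_comp x x' y y' : is_adjoint x x' -> is_adjoint y y' ->
  is_adjoint (x \o y) (y' \o x').
Proof. by move=> hx hy u v; rewrite /= hx hy. Qed.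

Lemma is_adjointD x x' y y' : is_adjoint x x' -> is_adjoint y y' ->
  is_adjoint (x + y) (x' + y').
Proof.
by move=> hx hy u v; rewrite !opDE linearDl /= hx hy -linearDr.
Qed.

Lemma is_adjointZ (a : R[i]) x x' : is_adjoint x x' ->
  is_adjoint (a *: x) (Num.conj a *: x').
Proof.
move=> hx u v; rewrite !opZE linearZl_LR /= hx [RHS]innerC linearZl_LR /=.
rewrite [in LHS]innerC; move: '[x' v, u] => [p q]; case: a => b c.
by apply/eqP; rewrite eq_complex; apply/andP; split; apply/eqP => /=; ring.
Qed.

Lemma conj_real (c : R) : Num.conj c%:C = c%:C.
Proof. by apply/eqP; rewrite eq_complex /= oppr0 !eqxx. Qed.

Lemma is_adjointZr (c : R) x x' : is_adjoint x x' ->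
  is_adjoint (c%:C *: x) (c%:C *: x').
Proof.
by move=> /(is_adjointZ c%:C); rewrite conj_real.
Qed.

Lemma is_adjointN x x' : is_adjoint x x' -> is_adjoint (- x) (- x').
Proof.
move=> /(is_adjointZr (-1)); rewrite rmorphN !scaleN1r.
by [].
Qed.

Lemma is_adjointB x x' y y' : is_adjoint x x' -> is_adjoint y y' ->
  is_adjoint (x - y) (x' - y').
Proof. by move=> hx hy; apply: is_adjointD => //; exact: is_adjointN. Qed.

Lemma is_adjoint0 : is_adjoint (0 : H -> H) 0.
Proof. by move=> u v; rewrite /= linear0l linear0r. Qed.

Lemma is_adjoint_sum (I : Type) (r : seq I) (Q : pred I) (F G : I -> H -> H) :
  (forall i, is_adjoint (F i) (G i)) ->
  is_adjoint (\sum_(i <- r | Q i) F i) (\sum_(i <- r | Q i) G i).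
Proof.
move=> h; elim/big_rec2: _ => [|i x y _ hxy]; first exact: is_adjoint0.
exact: is_adjointD.
Qed.

Context (B : set (H -> H)) (hB : forall b, B b -> bounded_op b).
Local Notation W := (commutant B).

Lemma comm_bounded x : W x -> bounded_op x. Proof. by case. Qed.

Lemma comm_linear x : W x -> linear x. Proof. by move=> [[]]. Qed.

Lemma comm_id : W idfun.
Proof. by split=> //; split=> // u; exact: cvg_id. Qed.

Lemma comm_lin (a : R[i]) x y : W x -> W y -> W (a *: x + y).
Proof.
move=> [[lx cx] hx] [[ly cy] hy]; split.
  split.
    move=> c u v; rewrite !opDE !opZE lx ly !scalerDr !scalerA mulrC.
    by rewrite addrACA.
  by move=> u; apply: cvgD; [apply: cvgZr; exact: cx|exact: cy].
move=> b Bb; apply/funext => u /=.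
have [lb _] := hB Bb.
have /(congr1 (@^~ u)) /= bx := hx _ Bb.
have /(congr1 (@^~ u)) /= by_ := hy _ Bb.
by rewrite !opDE !opZE lb bx by_.
Qed.

Lemma comm_comp x y : W x -> W y -> W (x \o y).
Proof.
move=> [[lx cx] hx] [[ly cy] hy]; split.
  split; first by move=> a u v /=; rewrite ly lx.
  by move=> u; apply: continuous_comp; [exact: cy|exact: cx].
move=> b Bb; have := hx _ Bb; have := hy _ Bb => byb bxb.
by rewrite compA bxb -compA byb compA.
Qed.

Lemma commD x y : W x -> W y -> W (x + y).
Proof. by move=> wx wy; rewrite -[x]scale1r; exact: comm_lin. Qed.

Lemma commB x y : W x -> W y -> W (x - y).
Proof. by move=> wx wy; rewrite addrC -scaleN1r; exact: comm_lin. Qed.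

Lemma comm0 : W 0.
Proof. by rewrite -(subrr idfun); apply: commB; exact: comm_id. Qed.

Lemma commZ (a : R[i]) x : W x -> W (a *: x).
Proof. by move=> wx; rewrite -[a *: x]addr0; apply: comm_lin => //; exact: comm0. Qed.

Lemma comm_sum (I : Type) (r : seq I) (Q : pred I) (F : I -> H -> H) :
  (forall i, W (F i)) -> W (\sum_(i <- r | Q i) F i).
Proof.
by move=> h; apply: (big_ind W) => //; [exact: comm0|exact: commD].
Qed.

(** For 0 <= h <= eta, the operator eta (eta h - h^2) is the sum of
    h (eta - h) h and (eta - h) h (eta - h), hence positive. *)
Lemma sqn_le_of_positive h (eta : R) : linear h -> is_adjoint h h -> 0 < eta ->
  (forall u, 0 <= ip (h u) u <= eta * sqn u) ->
  forall u, sqn (h u) <= eta ^+ 2 * sqn u.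
Proof.
move=> lh ah eta0 hh u.
have /andP[_ h1] := hh (h u).
have /andP[h2 _] := hh (eta%:C *: u - h u).
have /andP[_ h3] := hh u.
move: h1 h2 h3; rewrite (linB _ _ lh) (linZ _ _ lh).
rewrite ipBl !ipBr !ipZl !ipZr (ip_adjoint ah (h u) u).
rewrite -!/(sqn _) => h1 h2 h3.
suff : eta * sqn (h u) <= eta * (eta ^+ 2 * sqn u) by rewrite ler_pM2l.
have e2 : 0 < eta ^+ 2 by rewrite exprn_gt0.
by nra.
Qed.

Lemma nrD u v : complex.Re `|u + v| <= complex.Re `|u| + complex.Re `|v|.
Proof. by rewrite -ReD -lecR -norm_real RRe_real ?realD ?normr_real ?ler_normD. Qed.

Lemma nrZ (c : R) u : 0 <= c -> complex.Re `|c%:C *: u| = c * complex.Re `|u|.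
Proof. by move=> c0; rewrite normrZ ger0_norm ?ler0c// ReMr. Qed.

Lemma nrX_le u v (c : R) : 0 <= c ->
  complex.Re `|u| <= c * complex.Re `|v| -> sqn u <= c ^+ 2 * sqn v.
Proof.
move=> c0 h; rewrite !sqnE -exprMn.
by rewrite ler_pXn2r ?nnegrE ?mulr_ge0 ?Re_norm_ge0.
Qed.

Lemma nr_le u v : sqn u <= sqn v -> complex.Re `|u| <= complex.Re `|v|.
Proof. by rewrite !sqnE ler_pXn2r ?nnegrE ?Re_norm_ge0. Qed.

Lemma strong_cvg_comp (x : nat -> H -> H) X u :
  (forall n, linear (x n)) -> (forall n u, sqn (x n u) <= sqn u) ->
  (forall u, (fun n => x n u) @ \oo --> X u) ->
  (fun n => x n (x n u)) @ \oo --> X (X u).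
Proof.
move=> lx x1 hX; apply/cvg_sqnP => e e0.
have e4 : 0 < e / 4 by lra.
have [n1 h1] := (cvg_sqnP _ _).1 (hX u) _ e4.
have [n2 h2] := (cvg_sqnP _ _).1 (hX (X u)) _ e4.
exists (maxn n1 n2) => n; rewrite geq_max => /andP[/h1 {}h1 /h2 {}h2].
have -> : x n (x n u) - X (X u) = x n (x n u - X u) + (x n (X u) - X (X u)).
  by rewrite (linB _ _ (lx n)) addrA subrK.
apply: le_lt_trans (sqnD_le _ _) _.
by have := x1 n (x n u - X u); lra.
Qed.

(** Iterating y := (a + y^2)/2 with a = 1 - h^2 converges to 1 - |h|.  The
    scalar iteration s := (1 + s^2)/2 dominates it increment by increment, so
    the convergence is even uniform. *)
Lemma op_abs h : W h -> is_adjoint h h -> (forall u, sqn (h u) <= sqn u) ->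
  exists S, [/\ W S, is_adjoint S S, S \o S = h \o h & forall u, 0 <= ip (S u) u].
Proof.
move=> wh ah h1.
pose a := idfun - (h \o h).
have wa : W a by apply: commB; [exact: comm_id|exact: comm_comp].
have aa : is_adjoint a a.
  by apply: is_adjointB; [exact: is_adjoint_id|exact: is_adjoint_comp].
have aE u : a u = u - h (h u) by [].
have a1 u : complex.Re `|a u| <= complex.Re `|u|.
  apply: nr_le; rewrite aE sqnB -(ip_adjoint ah) -/(sqn _).
  by have := h1 (h u); have := sqn_ge0 (h u); lra.
pose y := fix y n : H -> H :=
  if n is m.+1 then (2^-1)%:C *: (a + (y m \o y m)) else 0.
pose s := fix s n : R := if n is m.+1 then 2^-1 * (1 + s m ^+ 2) else 0.
have yS n u : y n.+1 u = (2^-1)%:C *: (a u + y n (y n u)) by [].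
have sS n : s n.+1 = 2^-1 * (1 + s n ^+ 2) by [].
have ds n : 0 <= s n.+1 - s n.
  have -> : s n.+1 - s n = 2^-1 * (1 - s n) ^+ 2 by rewrite sS; field.
  by rewrite mulr_ge0 ?sqr_ge0//; lra.
have half0 : (0 : R) <= 2^-1 by lra.
have s01 n : 0 <= s n <= 1.
  elim: n => [|n /andP[s0 s1]] /=; first by rewrite lexx ler01.
  by apply/andP; split; nra.
have wy n : W (y n).
  elim: n => [|n wy] /=; first exact: comm0.
  by apply: commZ; apply: commD => //; exact: comm_comp.
have ly n : linear (y n) by exact: comm_linear.
have ay n : is_adjoint (y n) (y n).
  elim: n => [|n ayn] /=; first exact: is_adjoint0.
  by apply: is_adjointZr; apply: is_adjointD => //; exact: is_adjoint_comp.
have ys n u : complex.Re `|y n u| <= s n * complex.Re `|u|.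
  elim: n u => [|n IH] u; first by rewrite /= normr0 mul0r.
  rewrite yS nrZ// -mulrA ler_wpM2l// mulrDl mul1r.
  apply: le_trans (nrD _ _) _; apply: lerD => //.
  apply: le_trans (IH _) _; rewrite expr2 -mulrA ler_wpM2l//.
  by case/andP: (s01 n).
have yd n u : complex.Re `|y n.+1 u - y n u| <=
    (s n.+1 - s n) * complex.Re `|u|.
  elim: n u => [|n IH] u.
    by rewrite subr0 [s 0%N]/= subr0; exact: ys.
  rewrite [X in X - _]yS [X in _ - X]yS -scalerBr opprD addrACA subrr add0r nrZ//.
  have -> : y n.+1 (y n.+1 u) - y n (y n u) =
      y n.+1 (y n.+1 u - y n u) + (y n.+1 (y n u) - y n (y n u)).
    by rewrite (linB _ _ (ly _)) addrA subrK.
  have -> : (s n.+2 - s n.+1) * complex.Re `|u| =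
      2^-1 * (s n.+1 * ((s n.+1 - s n) * complex.Re `|u|) +
      (s n.+1 - s n) * (s n * complex.Re `|u|)).
    by rewrite [s n.+2]sS !(sS n); move: (s n) (complex.Re _) => p q; field.
  rewrite ler_wpM2l//; apply: le_trans (nrD _ _) _; apply: lerD.
    apply: le_trans (ys _ _) _; rewrite ler_wpM2l//; by case/andP: (s01 n.+1).
  by apply: le_trans (IH _) _; rewrite ler_wpM2l.
have sd m n : (n <= m)%N -> s n <= s m.
  move=> /subnK <-; elim: (m - n)%N => [|k IH]; first by rewrite add0n.
  by apply: le_trans IH _; rewrite addSn -subr_ge0.
have yc m n u : (n <= m)%N ->
    complex.Re `|y m u - y n u| <= (s m - s n) * complex.Re `|u|.
  move=> /subnK <-; elim: (m - n)%N => [|k IH].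
    by rewrite add0n !subrr normr0 mul0r.
  have -> : y (k.+1 + n)%N u - y n u =
      (y (k + n).+1 u - y (k + n)%N u) + (y (k + n)%N u - y n u).
    by rewrite addrA subrK addSn.
  apply: le_trans (nrD _ _) _; apply: le_trans (lerD (yd _ _) IH) _.
  by rewrite -mulrDl addrA subrK addSn.
have y1 n u : sqn (y n u) <= sqn u.
  rewrite -[leRHS]mul1r -(expr1n _ 2); apply: nrX_le => //.
  apply: le_trans (ys _ _) _; rewrite ler_wpM2r ?Re_norm_ge0//.
  by case/andP: (s01 n).
have [|Y [wY Y1 aY hY]] := strong_limit hB wy y1 ay.
  move=> u; exists (fun n => s n * sqn u), (sqn u); split.
    move=> m n nm; have smn : 0 <= s m - s n by rewrite subr_ge0 sd.
    apply: le_trans (nrX_le smn (yc _ _ _ nm)) _.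
    rewrite -mulrBl ler_wpM2r ?sqn_ge0//.
    by have := s01 m; have := s01 n; nra.
  move=> n; rewrite -[leRHS]mul1r ler_wpM2r ?sqn_ge0//.
  by case/andP: (s01 n).
have lY := comm_linear wY.
have YE u : Y u = (2^-1)%:C *: (a u + Y (Y u)).
  have c1 : (fun n => y n.+1 u) @ \oo --> Y u by have := hY u; rewrite -cvg_shiftS.
  have c2 : (fun n => y n.+1 u) @ \oo --> (2^-1)%:C *: (a u + Y (Y u)).
    rewrite (_ : (fun n => _) =
      fun n => (2^-1)%:C *: (a u + y n (y n u))); last exact/funext.
    by apply: cvgZr; apply: cvgD; [exact: cvg_cst|exact: strong_cvg_comp].
  exact: norm_cvg_unique c1 c2.
exists (idfun - Y); split.
- by apply: commB => //; exact: comm_id.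
- by apply: is_adjointB => //; exact: is_adjoint_id.
- apply/funext => u.
  have -> : ((idfun - Y) \o (idfun - Y)) u = (u - Y u) - Y (u - Y u) by [].
  rewrite (linB _ _ lY).
  have : (2 : R)%:C *: Y u = a u + Y (Y u).
    by rewrite {1}YE scalerA -rmorphM divff ?scale1r// pnatr_eq0.
  rewrite (_ : (2 : R)%:C = 1 + 1) ?rmorphD// scalerDl scale1r aE => E.
  have -> : u - Y u - (Y u - Y (Y u)) = u + Y (Y u) - (Y u + Y u).
    by rewrite opprB addrACA opprD [RHS]addrACA -!addrA; congr (_ + _);
       rewrite addrC -!addrA; congr (_ + _); rewrite addrC.
  by rewrite E opprD opprB addrACA [u + _]addrC subrK subrr addr0.
- move=> u; rewrite (_ : (idfun - Y) u = u - Y u)// ipBl -/(sqn u).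
  by have := ip_le (Y u) u; have := Y1 u; lra.
Qed.

End Commutants.

(** * Spectral projections *)

Section SpectralSteps.
Context {R : realType} {H : hilbertType R}.
Implicit Types (u v w : H) (x y h : H -> H).
Context (B : set (H -> H)) (hB : forall b, B b -> bounded_op b).
Local Notation W := (commutant B).
Context (abW : forall x y, W x -> W y -> forall u, x (y u) = y (x u)).

Lemma proj_idem (p : H -> H) : is_projection p -> forall u, p (p u) = p u.
Proof. by move=> [pp _] u; rewrite -[in RHS]pp. Qed.

Lemma proj_ip (p : H -> H) : is_projection p -> forall u, ip (p u) u = sqn (p u).
Proof.
by move=> hp u; rewrite /sqn -[in RHS](ip_adjoint hp.2) proj_idem.
Qed.

Lemma proj_sqn_le (p : H -> H) : is_projection p -> forall u, sqn (p u) <= sqn u.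
Proof.
move=> hp u; have := sqn_ge0 (u - p u).
by rewrite sqnB (ipC u) proj_ip//; lra.
Qed.

(** The powers of 1 - T^2 decrease to the projection onto the kernel of T. *)
Lemma kernel_projection T : W T -> is_adjoint T T ->
  (forall u, sqn (T u) <= sqn u) ->
  exists e, [/\ W e, is_projection e, forall u, T (e u) = 0 &
    forall u, T u = 0 -> e u = u].
Proof.
move=> wT aT T1.
pose b := idfun - (T \o T).
have bE u : b u = u - T (T u) by [].
have wb : W b by apply: (commB hB); [exact: comm_id|exact: comm_comp].
have ab : is_adjoint b b.
  by apply: is_adjointB; [exact: is_adjoint_id|exact: is_adjoint_comp].
have lb := comm_linear wb; have lT := comm_linear wT.
have b1 u : sqn (b u) <= sqn u.
  rewrite bE sqnB -(ip_adjoint aT) -/(sqn _).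
  by have := T1 (T u); have := sqn_ge0 (T u); lra.
pose x n : H -> H := iter n b.
have xS n u : x n (b u) = b (x n u) by rewrite /x -iterSr.
have wx n : W (x n).
  elim: n => [|n IH]; first exact: comm_id.
  by rewrite (_ : x n.+1 = b \o x n)//; exact: comm_comp.
have ax n : is_adjoint (x n) (x n).
  elim: n => [|n IH]; first exact: is_adjoint_id.
  have {2}-> : x n.+1 = x n \o b by apply/funext => u /=; rewrite xS.
  by rewrite (_ : x n.+1 = b \o x n)//; exact: is_adjoint_comp.
have x1 n u : sqn (x n u) <= sqn u.
  by elim: n => [|n IH] //=; apply: le_trans (b1 _) IH.
have xip m n u : ip (x m u) (x n u) = ip (x (m + n)%N u) u.
  rewrite ipC (ip_adjoint (ax n)) ipC; congr ip.
  by rewrite /x addnC iterD.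
have bpos v : 0 <= ip (b v) v.
  rewrite bE ipBl (ip_adjoint aT) -!/(sqn _).
  by have := T1 v; lra.
(* even powers are squares, and odd ones have a factor b between two copies
   of a power *)
have xpos n v : 0 <= ip (x n v) v.
  elim/ltn_ind: n v => -[|[|n]] IH v; [exact: sqn_ge0|exact: bpos|].
  rewrite (_ : x n.+2 v = b (x n.+1 v))// (ip_adjoint ab).
  rewrite (_ : x n.+1 v = x n (b v)); last by rewrite xS.
  by apply: IH; rewrite ltnS leqW.
pose c u n := ip (x n u) u.
have cdecr u m n : (n <= m)%N -> c u m <= c u n.
  move=> /subnK <-; elim: (m - n)%N => [|k]; first by rewrite add0n.
  apply: le_trans; rewrite addSn /c -subr_ge0 -ipBl.
  rewrite (_ : _ - _ = T (T (x (k + n)%N u))); last first.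
    by rewrite (_ : x (k + n).+1 u = b (x (k + n)%N u))// bE opprB addrC subrK.
  by rewrite (ip_adjoint aT) -(abW (wx _) wT) xpos.
have [|e [we _ ae he]] := strong_limit hB wx x1 ax.
  move=> u; exists (fun n => - c u (n + n)%N), 0; split.
    move=> m n nm; rewrite sqnB /sqn !xip opprK.
    have : c u (m + m)%N <= c u (m + n)%N by apply: cdecr; rewrite leq_add2l.
    by rewrite /c; lra.
  by move=> n; rewrite oppr_le0 xpos.
have be u : b (e u) = e u.
  have [lbb cb] := comm_bounded wb.
  have c1 : (fun n => x n.+1 u) @ \oo --> e u by have := he u; rewrite -cvg_shiftS.
  have c2 : (fun n => x n.+1 u) @ \oo --> b (e u).
    by apply: continuous_cvg; [exact: cb|exact: he].
  exact: norm_cvg_unique c2 c1.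
have Te u : T (e u) = 0.
  apply: sqn_eq0; rewrite /sqn (ip_adjoint aT) ipC.
  have : T (T (e u)) = 0.
    by have /eqP := be u; rewrite bE -subr_eq0 addrAC subrr add0r oppr_eq0 => /eqP.
  by move->; rewrite ip0l.
have fixe u : T u = 0 -> e u = u.
  move=> Tu; apply: norm_cvg_unique (he u) _.
  rewrite (_ : (fun n => x n u) = fun=> u); first exact: cvg_cst.
  apply/funext; elim=> [|n IH] //.
  by rewrite (_ : x n.+1 u = b (x n u))// IH bE Tu lin0// subr0.
exists e; split=> //; split=> //.
by apply/funext => u /=; exact: fixe.
Qed.

(** The spectral projection of h for the positive half line: the kernel
    projection of |h| - h.  On the complement |h| = - h, because |h| + h
    takes its values in that kernel. *)
Lemma sign_projection h : W h -> is_adjoint h h ->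
  exists e, [/\ W e, is_projection e,
    forall u, 0 <= ip (h (e u)) (e u) &
    forall u, ip (h (u - e u)) (u - e u) <= 0].
Proof.
move=> wh ah; have lh := comm_linear wh.
have [c c0 hc] := bounded_opP (comm_bounded wh).
have s0 : 0 < Num.sqrt c by rewrite sqrtr_gt0.
pose k := (Num.sqrt c)^-1; have k0 : 0 < k by rewrite invr_gt0.
have kc : k ^+ 2 * c = 1.
  by rewrite /k -{2}(sqr_sqrtr (ltW c0)) exprVn mulVf// expf_neq0// gt_eqF.
pose g := k%:C *: h.
have gE u : g u = k%:C *: h u by [].
have wg : W g by exact: (commZ hB).
have ag : is_adjoint g g by exact: is_adjointZr.
have lg := comm_linear wg.
have g1 u : sqn (g u) <= sqn u.
  rewrite gE sqnZ -[leRHS]mul1r -kc -(mulrA (k ^+ 2)).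
  by rewrite ler_wpM2l ?sqr_ge0.
have [S [wS aS SS Spos]] := op_abs hB wg ag g1.
have lS := comm_linear wS.
have SSu u : S (S u) = g (g u) by have /(congr1 (@^~ u)) := SS.
pose T := (2^-1)%:C *: (S - g).
have TE u : T u = (2^-1)%:C *: (S u - g u) by [].
have wT : W T by apply: (commZ hB); exact: (commB hB).
have aT : is_adjoint T T by apply: is_adjointZr; exact: is_adjointB.
have sS u : sqn (S u) = sqn (g u).
  by rewrite /sqn -(ip_adjoint aS) SSu (ip_adjoint ag).
have T1 u : sqn (T u) <= sqn u.
  rewrite TE sqnZ; have := sqnB_le (S u) (g u); rewrite sS.
  by have := g1 u; lra.
have [e [we pe Te ke]] := kernel_projection wT aT T1.
have le := comm_linear we.
have half u : T u = 0 -> S u = g u.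
  move=> /eqP; rewrite TE scaler_eq0 => /orP[|].
    by rewrite -[0]/(0%:C) eq_complex /= eqxx andbT invr_eq0 pnatr_eq0.
  by rewrite subr_eq0 => /eqP.
have gpos v : ip (g v) v = k * ip (h v) v by rewrite gE ipZl.
exists e; split=> // u.
  by have := Spos (e u); rewrite (half _ (Te u)) gpos pmulr_rge0.
set v := u - e u.
have Xv : S v = - g v.
  apply/eqP; rewrite -subr_eq0 opprK; apply/eqP.
  have TX w : T (S w + g w) = 0.
    rewrite TE (linD _ _ lS) (linD _ _ lg) SSu (abW wS wg).
    by rewrite [g (g w) + _]addrC subrr scaler0.
  have ev : e v = 0 by rewrite /v (linB _ _ le) (proj_idem pe) subrr.
  have := ke _ (TX v); rewrite (linD _ _ le) (abW we wS) (abW we wg) ev.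
  by rewrite (lin0 lS) (lin0 lg) addr0 => <-.
have := Spos v; rewrite Xv ipNl gpos oppr_ge0 pmulr_rle0//.
Qed.

(** Finite spectral resolution.  The steps are the differences of the sign
    projections of h - t_i at equally spaced levels t_i.  These decrease with i:
    on a vector in the range of a later one and in the kernel of an earlier one,
    h would be both above the larger and below the smaller level. *)
Lemma spectral_steps h (eta : R) : W h -> is_adjoint h h -> 0 < eta ->
  exists (n : nat) (t : R) (r : 'I_n -> H -> H),
  [/\ forall i, W (r i), forall i, is_projection (r i),
      forall i j, i != j -> forall u, r i (r j u) = 0,
      forall u, \sum_(i < n) r i u = u &
      forall u, sqn (h u - \sum_(i < n) (t + i%:R * eta)%:C *: r i u)
                <= eta ^+ 2 * sqn u].
Proof.
move=> wh ah eta0; have lh := comm_linear wh.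
have [c c0 hc] := bounded_opP (comm_bounded wh).
have hb u : `|ip (h u) u| <= (c + 1) * sqn u.
  have := ip_le (h u) u; have := ip_le (h u) (- u); rewrite sqnN ipNr.
  have := hc u; have := sqn_ge0 u => h1 h2 h3 h4.
  by rewrite ler_norml; apply/andP; split; nra.
(* the lowest level lies below the spectrum, which is inside [-(c+1), c+1] *)
pose t : R := - (c + 2).
pose lev (i : nat) : R := t + i%:R * eta.
have /choice[e he] : forall i : nat, exists e, [/\ W e, is_projection e,
    forall u, lev i * sqn (e u) <= ip (h (e u)) (e u) &
    forall u, ip (h (u - e u)) (u - e u) <= lev i * sqn (u - e u)].
  move=> i.
  have wg : W (h - (lev i)%:C *: idfun).
    by apply: (commB hB) => //; apply: (commZ hB); exact: comm_id.
  have ag : is_adjoint (h - (lev i)%:C *: idfun) (h - (lev i)%:C *: idfun).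
    by apply: is_adjointB => //; apply: is_adjointZr; exact: is_adjoint_id.
  have [e [we pe e1 e2]] := sign_projection wg ag.
  have E v : ip ((h - (lev i)%:C *: idfun) v) v = ip (h v) v - lev i * sqn v.
    by rewrite opBE ipBl opZE ipZl.
  exists e; split=> // u.
    by have := e1 u; rewrite E subr_ge0.
  by have := e2 u; rewrite E subr_le0.
have we i : W (e i) by case: (he i).
have pe i : is_projection (e i) by case: (he i).
have le_ i := comm_linear (we i).
have e1 i u : lev i * sqn (e i u) <= ip (h (e i u)) (e i u) by case: (he i).
have e2 i u : ip (h (u - e i u)) (u - e i u) <= lev i * sqn (u - e i u).
  by case: (he i).
have levlt i j : (i < j)%N -> lev i < lev j.
  by move=> ij; rewrite /lev ltrD2l ltr_pM2r// ltr_nat.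
have emono i j u : (i <= j)%N -> e j (e i u) = e j u.
  rewrite leq_eqVlt => /orP[/eqP <-|ij]; first by rewrite proj_idem.
  pose w := e j u - e j (e i u).
  have wj : e j w = w by rewrite /w (linB _ _ (le_ j)) !proj_idem.
  have wi : w - e i w = w.
    rewrite /w (linB _ _ (le_ i)) (abW (we i) (we j)) (abW (we i) (we j)).
    by rewrite proj_idem// subrr subr0.
  have := e1 j w; have := e2 i w; rewrite wj wi => h1 h2.
  have w0 : sqn w = 0.
    apply/eqP; rewrite eq_le sqn_ge0 andbT leNgt; apply/negP => wp.
    have : lev i * sqn w < lev j * sqn w by rewrite ltr_pM2r// levlt.
    by lra.
  by have /eqP := sqn_eq0 w0; rewrite subr_eq0 => /eqP.
have [n hn] : exists n : nat, c + 1 < lev n.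
  exists (Num.bound ((c + 2 + (c + 2)) / eta)).
  have := archi_boundP (_ : 0 <= (c + 2 + (c + 2)) / eta).
  rewrite divr_ge0 ?ltW//; last lra.
  by move=> /(_ isT); rewrite ltr_pdivrMr// /lev /t; lra.
have e0 u : e 0%N u = u.
  have := e2 0%N u; have := hb (u - e 0%N u); rewrite ler_norml => /andP[h1 _] h2.
  have : sqn (u - e 0%N u) = 0.
    have := sqn_ge0 (u - e 0%N u); move: h1 h2; rewrite /lev mul0r addr0 /t.
    by nra.
  by move=> /sqn_eq0/eqP; rewrite subr_eq0 => /eqP.
have en u : e n u = 0.
  have := e1 n u; have := hb (e n u); rewrite ler_norml => /andP[_ h1] h2.
  apply: sqn_eq0; have := sqn_ge0 (e n u) => h3.
  apply/eqP; rewrite eq_le h3 andbT leNgt; apply/negP => h4.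
  have : (c + 1) * sqn (e n u) < lev n * sqn (e n u) by rewrite ltr_pM2r.
  by lra.
pose r (i : nat) := e i - e i.+1.
have rE i u : r i u = e i u - e i.+1 u by [].
have wr i : W (r i) by exact: (commB hB).
have lr i := comm_linear (wr i).
have emono' i j u : (i <= j)%N -> e i (e j u) = e j u.
  by move=> ij; rewrite (abW (we i) (we j)) emono.
have er i u : e i (r i u) = r i u.
  by rewrite rE (linB _ _ (le_ i)) proj_idem// emono'.
have er' i u : e i.+1 (r i u) = 0.
  by rewrite rE (linB _ _ (le_ _)) proj_idem// emono// subrr.
have pr i : is_projection (r i).
  split; last by apply: is_adjointB; exact: (pe _).2.
  by apply/funext => u /=; rewrite [LHS]rE er er' subr0.
have rr_lt i j u : (i < j)%N -> r i (r j u) = 0.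
  move=> ij; rewrite -(er j) [LHS]rE emono' 1?ltnW// emono'// subrr.
  by [].
have rr i j u : i != j -> r i (r j u) = 0.
  rewrite neq_ltn => /orP[ij|ij]; first exact: rr_lt.
  by rewrite (abW (wr i) (wr j)) rr_lt.
have rsum u : \sum_(i < n) r i u = u.
  rewrite -(big_mkord xpredT (fun i => r i u)).
  under eq_bigr do rewrite rE -opprB.
  by rewrite sumrN telescope_sumr// en e0 sub0r opprK.
exists n, t, (fun i : 'I_n => r i); split=> //.
  by move=> i j ij u; apply: rr.
pose g : H -> H := h - \sum_(i < n) (lev i)%:C *: r i.
have gE u : g u = h u - \sum_(i < n) (lev i)%:C *: r i u.
  by rewrite /g opBE op_sumE.
have wg : W g by apply: (commB hB) => //; apply: (comm_sum hB) => i; exact: (commZ hB).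
have ag : is_adjoint g g.
  apply: is_adjointB => //; apply: is_adjoint_sum => i.
  by apply: is_adjointZr; exact: (pr i).2.
suff gpos u : 0 <= ip (g u) u <= eta * sqn u.
  by move=> u; rewrite -gE; apply: sqn_le_of_positive => //; exact: comm_linear wg.
have -> : ip (g u) u = \sum_(i < n) (ip (h (r i u)) (r i u) - lev i * sqn (r i u)).
  rewrite gE -{1}(rsum u) (lin_sum _ _ _ lh) -sumrB ip_suml; apply: eq_bigr => i _.
  rewrite ipBl ipZl proj_ip//; congr (_ - _).
  by rewrite -[RHS](ip_adjoint (pr i).2) -(abW wh (wr i)) proj_idem.
have <- : \sum_(i < n) sqn (r i u) = sqn u.
  rewrite /sqn -[in RHS](rsum u) ip_suml; apply: eq_bigr => i _.
  by rewrite rsum proj_ip.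
rewrite mulr_sumr; apply/andP; split.
  apply: sumr_ge0 => i _; rewrite subr_ge0.
  by have := e1 i (r i u); rewrite er.
apply: ler_sum => i _; have := e2 i.+1 (r i u); rewrite er' subr0.
have -> : lev i.+1 = lev i + eta by rewrite /lev -natr1; ring.
by lra.
Qed.

End SpectralSteps.

(** * Sparse cuts of weighted graphs on the integers *)

Section CutLemma.
Context {R : realFieldType}.

Lemma sum_odd_below (N a : nat) : (a <= N)%N ->
  \sum_(k < N) (2 * k%:R + 1) * ((k < a)%N)%:R = a%:R ^+ 2 :> R.
Proof.
move=> aN; rewrite (bigID (fun k : 'I_N => (k < a)%N)) /= addrC big1 ?add0r; last first.
  by move=> k /negbTE ->; rewrite mulr0.
under eq_bigr => k ka do rewrite ka mulr1.
rewrite -(big_ord_widen N (fun k => 2 * k%:R + 1 : R)) //.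
elim: a {aN} => [|a IH]; first by rewrite big_ord0 expr0n.
by rewrite big_ord_recr /= IH -natr1; ring.
Qed.

(** The left side is |a^2 - b^2|, so this is the inequality of arithmetic and
    geometric means for the factors a - b and a + b. *)
Lemma sum_odd_between (theta : R) (N a b : nat) : 0 < theta ->
  (a <= N)%N -> (b <= N)%N ->
  \sum_(k < N) (2 * k%:R + 1) * (((k < a) != (k < b))%N)%:R <=
  (2 * theta)^-1 * (a%:R - b%:R) ^+ 2 + theta / 2 * (a%:R + b%:R) ^+ 2 :> R.
Proof.
move=> t0; wlog ab : a b / (a <= b)%N => [hw aN bN|aN bN].
  have [ab|/ltnW ba] := leqP a b; first exact: hw.
  have := hw _ _ ba bN aN; rewrite -sqrrN opprB [b%:R + _]addrC.
  by under eq_bigr do rewrite eq_sym.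
have -> : \sum_(k < N) (2 * k%:R + 1) * (((k < a) != (k < b))%N)%:R =
    b%:R ^+ 2 - a%:R ^+ 2 :> R.
  rewrite -(sum_odd_below aN) -(sum_odd_below bN) -sumrB.
  apply: eq_bigr => k _; rewrite -mulrBr; congr (_ * _).
  have [ka|ka] := ltnP k a; first by rewrite (leq_trans ka ab) subrr.
  by case: (k < b)%N; rewrite subr0.
rewrite subr_sqr -subr_ge0.
set x := b%:R - a%:R; set y := b%:R + a%:R.
have -> : (2 * theta)^-1 * (a%:R - b%:R) ^+ 2 + theta / 2 * (a%:R + b%:R) ^+ 2
    - x * y = (2 * theta)^-1 * (x - theta * y) ^+ 2 :> R.
  by rewrite /x /y; field; rewrite gt_eqF.
by rewrite mulr_ge0 ?sqr_ge0// invr_ge0; lra.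
Qed.

(** The least m above which at most half of the mass lies. *)
Lemma weighted_median (n : nat) (v : 'I_n -> R) : (forall i, 0 <= v i) ->
  exists m : nat, 2 * \sum_(i : 'I_n | (m < i)%N) v i <= \sum_i v i /\
    2 * \sum_(i : 'I_n | (i < m)%N) v i <= \sum_i v i.
Proof.
move=> v0; pose P m := 2 * \sum_(i < n | (m < i)%N) v i <= \sum_(i < n) v i.
have exP : exists m, P m.
  exists n; rewrite /P big_pred0 ?mulr0 ?sumr_ge0// => i.
  by rewrite ltnNge ltnW.
case: (ex_minnP exP) => m Pm mmin; exists m; split=> //.
case: m Pm mmin => [|m] _ mmin.
  by rewrite big_pred0 ?mulr0 ?sumr_ge0.
have : ~~ P m by apply/negP => /mmin; rewrite ltnn.
rewrite /P -ltNge => h.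
have E : \sum_i v i = \sum_(i < n | (m < i)%N) v i + \sum_(i < n | (i < m.+1)%N) v i.
  rewrite (bigID (fun i : 'I_n => (m < i)%N)) /=; congr (_ + _).
  by apply: eq_bigl => i; rewrite -leqNgt ltnS.
by rewrite E in h *; lra.
Qed.

(** If the superlevel sets of c all had boundary more than delta times their
    mass, summing over the levels with the weights 2k+1 would contradict
    Cauchy-Schwarz: the weights turn masses into the second moment of c and
    boundaries into the differences |c_i^2 - c_j^2|. *)
Lemma layer_cake_cut (n N : nat) (v : 'I_n -> R) (w : 'I_n -> 'I_n -> R)
    (c : 'I_n -> nat) (b delta theta D : R) :
  (forall i, 0 <= v i) -> (forall i j, 0 <= w i j) ->
  (forall i, \sum_j w i j <= b * v i) -> (forall j, \sum_i w i j <= b * v j) ->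
  (forall i, (c i <= N)%N) -> 0 < theta ->
  \sum_i \sum_j ((c i)%:R - (c j)%:R) ^+ 2 * w i j <= D ->
  (2 * theta)^-1 * D + 2 * b * theta * (\sum_i (c i)%:R ^+ 2 * v i) <
    delta * \sum_i (c i)%:R ^+ 2 * v i ->
  exists k : nat, let A i := (k < c i)%N in
    0 < \sum_(i | A i) v i /\
    \sum_i \sum_j (A i != A j)%:R * w i j <= delta * \sum_(i | A i) v i.
Proof.
move=> v0 w0 wr wc cN t0 hD hlt.
set X := \sum_i _ in hlt.
pose mass k := \sum_(i | (k < c i)%N) v i.
pose cut k := \sum_i \sum_j ((k < c i)%N != (k < c j)%N)%:R * w i j.
have cut0 k : 0 <= cut k.
  by apply: sumr_ge0 => i _; apply: sumr_ge0 => j _; rewrite mulr_ge0.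
have mass0 k : 0 <= mass k by apply: sumr_ge0.
apply: contrapT => hno.
have hk k : delta * mass k <= cut k.
  rewrite leNgt; apply/negP => hc; apply: hno; exists k => /=; split; last exact: ltW.
  rewrite lt_neqAle mass0 andbT eq_sym; apply: contraTneq hc => mz.
  by rewrite [mass k]mz mulr0 -leNgt.
have massX : X = \sum_(k < N) (2 * k%:R + 1) * mass k.
  rewrite /X; under eq_bigr => i _ do rewrite -(sum_odd_below (cN i)) mulr_suml.
  rewrite exchange_big; apply: eq_bigr => k _.
  rewrite /mass [in RHS]big_mkcond mulr_sumr; apply: eq_bigr => i _.
  by case: (k < c i)%N; rewrite ?mulr1// !mulr0 mul0r.
have : delta * X <= \sum_(k < N) (2 * k%:R + 1) * cut k.
  rewrite massX mulr_sumr; apply: ler_sum => k _.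
  by rewrite mulrCA ler_wpM2l ?hk.
apply/negP; rewrite -ltNge; apply: le_lt_trans hlt.
have -> : \sum_(k < N) (2 * k%:R + 1) * cut k =
    \sum_i \sum_j (\sum_(k < N) (2 * k%:R + 1) *
       ((k < c i)%N != (k < c j)%N)%:R) * w i j.
  rewrite /cut; under eq_bigr => k _ do rewrite mulr_sumr.
  rewrite exchange_big; apply: eq_bigr => i _.
  under eq_bigr => k _ do rewrite mulr_sumr.
  rewrite exchange_big; apply: eq_bigr => j _.
  by rewrite mulr_suml; apply: eq_bigr => k _; rewrite mulrA.
apply: (@le_trans _ _ (\sum_i \sum_j
    ((2 * theta)^-1 * (((c i)%:R - (c j)%:R) ^+ 2 * w i j) +
     (theta * ((c i)%:R ^+ 2 * w i j) + theta * ((c j)%:R ^+ 2 * w i j))))).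
  apply: ler_sum => i _; apply: ler_sum => j _.
  apply: le_trans (ler_wpM2r (w0 i j) (sum_odd_between t0 (cN i) (cN j))) _.
  rewrite -subr_ge0; move: (w0 i j); move: (w i j) => z z0.
  move: ((c i)%:R) ((c j)%:R) => x y.
  have -> : (2 * theta)^-1 * ((x - y) ^+ 2 * z) +
      (theta * (x ^+ 2 * z) + theta * (y ^+ 2 * z)) -
      ((2 * theta)^-1 * (x - y) ^+ 2 + theta / 2 * (x + y) ^+ 2) * z =
      theta * ((x - y) ^+ 2 * z / 2) by field; rewrite gt_eqF.
  apply: mulr_ge0; first exact: ltW.
  by rewrite divr_ge0// mulr_ge0// sqr_ge0.
under eq_bigr => i _ do rewrite !big_split /= -!mulr_sumr.
rewrite !big_split /= -!mulr_sumr.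
have XR : \sum_i (c i)%:R ^+ 2 * (\sum_j w i j) <= b * X.
  rewrite /X mulr_sumr; apply: ler_sum => i _.
  by rewrite mulrCA ler_wpM2l// sqr_ge0.
have XC : \sum_i \sum_j (c j)%:R ^+ 2 * w i j <= b * X.
  rewrite exchange_big /= /X mulr_sumr; apply: ler_sum => j _.
  by rewrite -mulr_sumr mulrCA ler_wpM2l// sqr_ge0.
apply: lerD; first by rewrite ler_wpM2l// invr_ge0; lra.
by nra.
Qed.

(** A weighted graph on consecutive integers in which i - j has small energy
    compared with the variance of the masses has a sparse cut.  Centering at a
    median makes the level sets of both the positive and the negative part
    carry at most half of the mass. *)
Lemma sparse_cut (b delta : R) : 0 <= b -> 0 < delta ->
  exists2 gamma : R, 0 < gamma &
  forall (n : nat) (v : 'I_n -> R) (w : 'I_n -> 'I_n -> R),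
  (forall i, 0 <= v i) -> (forall i j, 0 <= w i j) ->
  (forall i, \sum_j w i j <= b * v i) -> (forall j, \sum_i w i j <= b * v j) ->
  (forall m : nat, 0 < \sum_(i < n) (i%:R - m%:R) ^+ 2 * v i) ->
  (forall m : nat, \sum_(i < n) \sum_(j < n) (i%:R - j%:R) ^+ 2 * w i j <=
     gamma * \sum_(i < n) (i%:R - m%:R) ^+ 2 * v i) ->
  exists A : pred 'I_n, [/\ 0 < \sum_(i | A i) v i,
    2 * \sum_(i | A i) v i <= \sum_i v i &
    \sum_i \sum_j (A i != A j)%:R * w i j <= delta * \sum_(i | A i) v i].
Proof.
(* with these theta and gamma the two error terms of [layer_cake_cut] are at
   most delta/4 and delta/2 times the second moment *)
move=> b0 d0; pose theta := delta / (4 * b + 4).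
have b4 : 0 < 4 * b + 4 by lra.
have t0 : 0 < theta by rewrite divr_gt0.
have tE : theta * (4 * b + 4) = delta by rewrite /theta divfK// gt_eqF.
clearbody theta; exists (theta * delta / 4); first by apply: divr_gt0; [exact: mulr_gt0|rewrite ltr0n].
move=> n v w v0 w0 wr wc var ene.
have [m [mgt mlt]] := weighted_median v0.
set Y := \sum_(i < n) (i%:R - m%:R) ^+ 2 * v i in var ene.
have /= Y0 := var m; have /= eneY := ene m; rewrite -/Y in Y0 eneY.
pose c1 (i : 'I_n) := (i - m)%N; pose c2 (i : 'I_n) := (m - i)%N.
have subnr (p q : nat) : ((p - q)%N)%:R = (if (q <= p)%N then p%:R - q%:R else 0) :> R.
  by case: leqP => [/natrB//|/ltnW]; rewrite -subn_eq0 => /eqP ->.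
have YE : Y = \sum_i (c1 i)%:R ^+ 2 * v i + \sum_i (c2 i)%:R ^+ 2 * v i.
  rewrite /Y -big_split; apply: eq_bigr => i _ /=; rewrite -mulrDl; congr (_ * _).
  rewrite /c1 /c2 !subnr; case: ltngtP => [im|im|->]; rewrite ?subrr; ring.
have lip1 i j : ((c1 i)%:R - (c1 j)%:R) ^+ 2 <= (i%:R - j%:R) ^+ 2 :> R.
  rewrite /c1 !subnr; case: leqP => im; case: leqP => jm.
  - by rewrite opprB addrA subrK.
  - by move: im jm; rewrite -(ltr_nat R) -(ler_nat R) => im jm; nra.
  - by move: im jm; rewrite -(ltr_nat R) -(ler_nat R) => im jm; nra.
  - by rewrite subrr expr0n sqr_ge0.
have lip2 i j : ((c2 i)%:R - (c2 j)%:R) ^+ 2 <= (i%:R - j%:R) ^+ 2 :> R.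
  rewrite /c2 !subnr; case: leqP => im; case: leqP => jm.
  - by rewrite opprB addrC subrKA -sqrrN opprB.
  - by move: im jm; rewrite -(ltr_nat R) -(ler_nat R) => im jm; nra.
  - by move: im jm; rewrite -(ltr_nat R) -(ler_nat R) => im jm; nra.
  - by rewrite subrr expr0n sqr_ge0.
have main (c : 'I_n -> nat) (N : nat) : (forall i, (c i <= N)%N) ->
    (forall i j, ((c i)%:R - (c j)%:R) ^+ 2 <= (i%:R - j%:R) ^+ 2 :> R) ->
    2 * \sum_(i | (0 < c i)%N) v i <= \sum_i v i ->
    Y <= 2 * \sum_i (c i)%:R ^+ 2 * v i ->
    exists A : pred 'I_n, [/\ 0 < \sum_(i | A i) v i,
      2 * \sum_(i | A i) v i <= \sum_i v i &
      \sum_i \sum_j (A i != A j)%:R * w i j <= delta * \sum_(i | A i) v i].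
  move=> cN lip half; set X := \sum_i _ * _ => YX.
  have [||k [k1 k2]] := layer_cake_cut (delta := delta)
    (D := theta * delta / 4 * (2 * X)) v0 w0 wr wc cN t0.
  - apply: le_trans (_ : \sum_(i < n) \sum_(j < n) (i%:R - j%:R) ^+ 2 * w i j <= _).
      by apply: ler_sum => i _; apply: ler_sum => j _; rewrite ler_wpM2r.
    apply: le_trans eneY _; rewrite ler_wpM2l// divr_ge0 ?mulr_ge0 ?ltW//.
  - rewrite -/X.
    have -> : (2 * theta)^-1 * (theta * delta / 4 * (2 * X)) = delta / 4 * X.
      by field; rewrite gt_eqF.
    have X0 : 0 < X by lra.
    rewrite -mulrDl ltr_pM2r//.
    by nra.
  exists (fun i => (k < c i)%N); split=> //.
  apply: le_trans half; rewrite ler_wpM2l// ?ler0n//.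
  rewrite [leRHS](bigID (fun i => (k < c i)%N)) /=.
  rewrite [X in _ <= X + _](eq_bigl (fun i => (k < c i)%N)); last first.
    by move=> i; case: (ltnP k (c i)) => [/(leq_trans (ltn0Sn _)) ->|_]; rewrite ?andbF.
  by rewrite lerDl sumr_ge0.
have [h|h] := leP Y (2 * \sum_i (c1 i)%:R ^+ 2 * v i).
  apply: (main c1 n) => //; first by move=> i; rewrite leq_subLR (leq_trans (ltnW (ltn_ord i)))// leq_addl.
  by under eq_bigl do rewrite subn_gt0.
apply: (main c2 m) => //; first by move=> i; rewrite leq_subr.
  by under eq_bigl do rewrite subn_gt0.
by lra.
Qed.

End CutLemma.

(** * Maximal elements by ascent *)

(** A sequential substitute for Zorn's lemma: if each step of an ascending
    sequence gains at least half of what can still be gained, an upper bound of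
    the sequence leaves nothing to gain. *)
Lemma maximal_element {R : realType} (T : Type) (D : set T) (le : T -> T -> Prop)
    (f : T -> R) (c : R) (x0 : T) :
  D x0 -> (forall x, D x -> le x x) ->
  (forall x y z, le x y -> le y z -> le x z) ->
  (forall x y, D x -> D y -> le x y -> f x <= f y) -> (forall x, D x -> f x <= c) ->
  (forall s : nat -> T, (forall n, D (s n)) -> (forall n, le (s n) (s n.+1)) ->
     exists2 y, D y & forall n, le (s n) y) ->
  exists2 x, D x & forall y, D y -> le x y -> f y <= f x.
Proof.
move=> D0 lexx_ letr fmono fc chains.
have step (x : T) : exists y, D x -> [/\ D y, le x y &
    forall z, D z -> le x z -> f z <= 2 * f y - f x].
  have [Dx|] := pselect (D x); last by exists x.
  pose E := [set f z | z in [set z | D z /\ le x z]].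
  have supE : has_sup E.
    split; first by exists (f x), x => //; split=> //; exact: lexx_.
    by exists c => _ [z [Dz _] <-]; exact: fc.
  have [gain|] := ltP (f x) (sup E); last first.
    move=> supx; exists x => _; split=> // [|z Dz xz]; first exact: lexx_.
    have : f z <= sup E by apply: ub_le_sup; [exact: supE.2|exists z].
    by lra.
  have gain0 : 0 < (sup E - f x) / 2 by lra.
  have [_ [y [Dy xy] <-] hy] := sup_adherent gain0 supE.
  exists y => _; split=> // z Dz xz.
  have : f z <= sup E by apply: ub_le_sup; [exact: supE.2|exists z].
  by lra.
have [next hnext] := choice step.
pose s n := iter n next x0.
have Ds n : D (s n) by elim: n => [|n IH] //=; case: (hnext _ IH).
have lts n : le (s n) (s n.+1) by case: (hnext _ (Ds n)).
have [y Dy sy] := chains s Ds lts.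
exists y => // z Dz yz; rewrite leNgt; apply/negP => fyz.
have inc n : f z - f y <= f (s n.+1) - f (s n).
  have [_ _ /(_ z Dz (letr _ _ _ (sy n) yz))] := hnext _ (Ds n).
  have := fmono _ _ (Ds n.+1) Dy (sy n.+1).
  rewrite (_ : next (s n) = s n.+1)//; lra.
have grow n : f (s 0%N) + n%:R * (f z - f y) <= f (s n).
  elim: n => [|n IH]; first by rewrite mul0r addr0.
  by have := inc n; rewrite -natr1; lra.
have d0 : 0 < f z - f y by rewrite subr_gt0.
have q0 : 0 <= (c - f (s 0%N)) / (f z - f y).
  by rewrite divr_ge0 ?(ltW d0)// subr_ge0 fc.
have := archi_boundP q0; rewrite ltr_pdivrMr//.
by have := grow (Num.bound ((c - f (s 0%N)) / (f z - f y)));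
   have := fc _ (Ds (Num.bound ((c - f (s 0%N)) / (f z - f y)))); lra.
Qed.

(** * Von Neumann algebras, adjoints and projections *)

Section VonNeumannAlgebras.
Context {R : realType} {H : hilbertType R}.
Context (A : set (H -> H)) (hA : von_neumann_algebra A).
Implicit Types x y : H -> H.

Let bA : forall b, commutant A b -> bounded_op b.
Proof. by move=> b []. Qed.

Lemma vna_bounded x : A x -> bounded_op x.
Proof. by rewrite -(vna_bicommutant hA) => -[]. Qed.

Lemma vna_linear x : A x -> linear x.
Proof. by move=> /vna_bounded[]. Qed.

Lemma vna_id : A idfun.
Proof. by rewrite -(vna_bicommutant hA); exact: comm_id. Qed.

Lemma vna_comp x y : A x -> A y -> A (x \o y).
Proof. by rewrite -(vna_bicommutant hA); exact: comm_comp. Qed.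

Lemma vnaD x y : A x -> A y -> A (x + y).
Proof. by rewrite -(vna_bicommutant hA); exact: commD. Qed.

Lemma vnaB x y : A x -> A y -> A (x - y).
Proof. by rewrite -(vna_bicommutant hA); exact: commB. Qed.

Lemma vnaZ (a : R[i]) x : A x -> A (a *: x).
Proof. by rewrite -(vna_bicommutant hA); exact: commZ. Qed.

Lemma vna0 : A 0.
Proof. by rewrite -(vna_bicommutant hA); exact: comm0. Qed.

Lemma vna_sum (I : Type) (r : seq I) (Q : pred I) (F : I -> H -> H) :
  (forall i, A (F i)) -> A (\sum_(i <- r | Q i) F i).
Proof. by rewrite -(vna_bicommutant hA); exact: comm_sum. Qed.

End VonNeumannAlgebras.

Section Adjoints.
Context {R : realType} {H : hilbertType R}.
Implicit Types x y : H -> H.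

Lemma is_adjoint_uniq x y y' : is_adjoint x y -> is_adjoint x y' -> y = y'.
Proof.
move=> h h'; apply/funext => v; apply/eqP; rewrite -subr_eq0; apply/eqP.
apply: sqn_eq0; rewrite /sqn ipBr -(ip_adjoint h) -(ip_adjoint h').
by rewrite subrr.
Qed.

Lemma adj_eq x y : is_adjoint x y -> adj x = y.
Proof.
move=> h; apply: (is_adjoint_uniq _ h).
by rewrite /adj; apply: (@xgetPex _ 0 (is_adjoint x)); exists y.
Qed.

Lemma pythagoras (I : finType) (F : I -> H) :
  (forall i j, i != j -> ip (F i) (F j) = 0) ->
  sqn (\sum_i F i) = \sum_i sqn (F i).
Proof.
move=> h; rewrite {1}/sqn ip_suml; apply: eq_bigr => i _.
rewrite ip_sumr (bigD1 i)//= big1 ?addr0// => j ji.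
by apply: h; rewrite eq_sym.
Qed.

Lemma proj_absorb (p q : H -> H) : is_projection p -> is_projection q ->
  (forall u, q (p u) = p u) -> forall u, p (q u) = p u.
Proof.
move=> hp hq qp u.
have e : q \o p = p by apply/funext.
have := is_adjoint_comp hq.2 hp.2; rewrite e => h.
exact: (congr1 (@^~ u) (esym (is_adjoint_uniq hp.2 h))).
Qed.

Lemma proj_diff (p q : H -> H) : linear p -> linear q -> is_projection p ->
  is_projection q -> (forall u, q (p u) = p u) -> is_projection (q - p).
Proof.
move=> lp lq hp hq qp; have pq := proj_absorb hp hq qp.
split; last by apply: is_adjointB; [exact: hq.2|exact: hp.2].
apply/funext => u; rewrite /= !opBE (linB _ _ lq) (linB _ _ lp).
by rewrite qp pq !proj_idem// subrr subr0.
Qed.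

Lemma proj_compl (p : H -> H) : linear p -> is_projection p ->
  is_projection (idfun - p).
Proof. by move=> lp hp; apply: proj_diff. Qed.

Lemma proj_sum (p q : H -> H) : linear p -> linear q -> is_projection p ->
  is_projection q -> (forall u, p (q u) = 0) -> is_projection (p + q).
Proof.
move=> lp lq hp hq pq.
have qp u : q (p u) = 0.
  by apply: sqn_eq0; rewrite /sqn (ip_adjoint hq.2) (ip_adjoint hp.2) pq ip0r.
split; last by apply: is_adjointD; [exact: hp.2|exact: hq.2].
apply/funext => u; rewrite /= !opDE (linD _ _ lp) (linD _ _ lq).
by rewrite qp pq !proj_idem// addr0 add0r.
Qed.

Lemma proj_positive (p : H -> H) : is_projection p -> positive p.
Proof. by move=> hp u; rewrite -(proj_idem hp) hp.2 inner_sqn ler0c sqn_ge0. Qed.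

Lemma proj_sqnB (p q : H -> H) : is_projection p -> is_projection q ->
  (forall u, q (p u) = p u) ->
  forall u, sqn (q u - p u) = sqn (q u) - sqn (p u).
Proof.
move=> hp hq qp u; rewrite sqnB (ip_adjoint hq.2) qp ipC proj_ip//.
by ring.
Qed.

End Adjoints.

(** * Calculus in the standard form *)

Section StandardFormCalculus.
Context {R : realType} {K L : hilbertType R}.
Context (M : set (K -> K)) (hM : von_neumann_algebra M).
Context (phi : (K -> K) -> R[i]) (hphi : faithful_normal_state M phi).
Context (rho : (K -> K) -> L -> L) (J : L -> L) (P : set L).
Context (hL : standard_form M rho J P).
Context (xiphi : L) (hxiphi : state_vector M rho P phi xiphi).
Implicit Types (x y p q : K -> K) (u v xi : L).

Let iso := std_iso hL.

Lemma rho_bounded x : M x -> bounded_op (rho x).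
Proof. by move=> Mx; apply: (vna_bounded (siso_image iso)); exists x. Qed.

Lemma rho_linear x : M x -> linear (rho x).
Proof. by move=> /rho_bounded[]. Qed.

Lemma rho_comp x y u : M x -> M y -> rho (x \o y) u = rho x (rho y u).
Proof. by move=> Mx My; rewrite (siso_mul iso). Qed.

Lemma rhoD x y u : M x -> M y -> rho (x + y) u = rho x u + rho y u.
Proof.
by move=> Mx My; rewrite -{1}[x]scale1r (siso_linear iso) // scale1r.
Qed.

Lemma rho0 u : rho 0 u = 0.
Proof.
have M0 := vna0 hM; apply: (addrI (rho 0 u)).
by rewrite -rhoD// !addr0.
Qed.

Lemma rhoZ (a : R[i]) x u : M x -> rho (a *: x) u = a *: rho x u.
Proof.
move=> Mx; rewrite -[a *: x]addr0 (siso_linear iso)//; last exact: (vna0 hM).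
by rewrite opDE rho0 addr0.
Qed.

Lemma rhoB x y u : M x -> M y -> rho (x - y) u = rho x u - rho y u.
Proof.
move=> Mx My; have My' : M (-1 *: y) by exact: (vnaZ hM).
by rewrite (_ : x - y = x + -1 *: y) ?scaleN1r// -scaleN1r rhoD// rhoZ// scaleN1r.
Qed.

Lemma rho_sum (I : Type) (r : seq I) (Q : pred I) (F : I -> K -> K) u :
  (forall i, M (F i)) ->
  rho (\sum_(i <- r | Q i) F i) u = \sum_(i <- r | Q i) rho (F i) u.
Proof.
move=> MF; elim: r => [|i r IH]; first by rewrite !big_nil rho0.
rewrite !big_cons; case: ifP => _ //; rewrite rhoD ?IH//.
exact: (vna_sum hM).
Qed.

Lemma rho_id u : rho idfun u = u.
Proof.
have Mi := vna_id hM.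
have [e Me re] := vna_id (siso_image iso).
rewrite -[LHS](_ : rho e (rho idfun u) = _); last by rewrite re.
by rewrite -rho_comp// (_ : e \o idfun = e)// re.
Qed.

Lemma rho_adjoint x y : M x -> M y -> is_adjoint x y ->
  is_adjoint (rho x) (rho y).
Proof. exact: siso_adj. Qed.

Lemma rho_projection p : M p -> is_projection p -> is_projection (rho p).
Proof.
move=> Mp [pp ap]; split; last exact: rho_adjoint.
by apply/funext => u /=; rewrite -rho_comp// pp.
Qed.

Lemma JD u v : J (u + v) = J u + J v.
Proof.
by rewrite -[u]scale1r (std_J_antilinear hL) rmorph1 !scale1r.
Qed.

Lemma J0 : J 0 = 0.
Proof. by apply: (addrI (J 0)); rewrite -JD !addr0. Qed.

Lemma JZ (a : R[i]) u : J (a *: u) = Num.conj a *: J u.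
Proof. by rewrite -[a *: u]addr0 (std_J_antilinear hL) J0 addr0. Qed.

Lemma JZr (c : R) u : J (c%:C *: u) = c%:C *: J u.
Proof. by rewrite JZ conj_real. Qed.

Lemma JN u : J (- u) = - J u.
Proof.
by rewrite (_ : - u = (-1)%:C *: u) ?JZr rmorphN1 ?scaleN1r.
Qed.

Lemma JB u v : J (u - v) = J u - J v.
Proof. by rewrite JD JN. Qed.

Lemma JK u : J (J u) = u.
Proof. exact: (std_J_involutive hL). Qed.

Lemma ip_J u v : ip (J u) (J v) = ip u v.
Proof. by rewrite /ip (std_J_isometry hL) -!/(ip _ _) ipC. Qed.

Lemma sqn_J u : sqn (J u) = sqn u.
Proof. exact: ip_J. Qed.

(** For self-adjoint x this is the right action of x.  Without the adjoint of
    the right action it is multiplicative and commutes with the left action of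
    M. *)
Definition rr x u := J (rho x (J u)).

Lemma rho_rr x y u : M x -> M y -> rho x (rr y u) = rr y (rho x u).
Proof.
move=> Mx My.
have : commutant (rho @` M) (J \o rho y \o J).
  by rewrite -(std_JMJ hL); exists (rho y) => //; exists y.
case=> _ /(_ (rho x)) h.
by have /(congr1 (@^~ u)) := h (ex_intro2 _ _ x Mx erefl).
Qed.

Lemma rr_comp x y u : M x -> M y -> rr (x \o y) u = rr x (rr y u).
Proof. by move=> Mx My; rewrite /rr JK rho_comp. Qed.

Lemma rrDr x u v : M x -> rr x (u + v) = rr x u + rr x v.
Proof. by move=> Mx; rewrite /rr JD (linD _ _ (rho_linear Mx)) JD. Qed.

Lemma rrBr x u v : M x -> rr x (u - v) = rr x u - rr x v.
Proof. by move=> Mx; rewrite /rr JB (linB _ _ (rho_linear Mx)) JB. Qed.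

Lemma rrNr x u : M x -> rr x (- u) = - rr x u.
Proof. by move=> Mx; rewrite /rr JN (linN _ (rho_linear Mx)) JN. Qed.

Lemma rrZr x (a : R[i]) u : M x -> rr x (a *: u) = a *: rr x u.
Proof. by move=> Mx; rewrite /rr JZ (linZ _ _ (rho_linear Mx)) JZ conjCK. Qed.

Lemma rrZ (c : R) x u : M x -> rr (c%:C *: x) u = c%:C *: rr x u.
Proof. by move=> Mx; rewrite /rr rhoZ// JZr. Qed.

Lemma rrB x y u : M x -> M y -> rr (x - y) u = rr x u - rr y u.
Proof. by move=> Mx My; rewrite /rr rhoB// JB. Qed.

Lemma rr_sum (I : Type) (r : seq I) (Q : pred I) (F : I -> K -> K) u :
  (forall i, M (F i)) ->
  rr (\sum_(i <- r | Q i) F i) u = \sum_(i <- r | Q i) rr (F i) u.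
Proof.
by move=> MF; rewrite /rr rho_sum// (big_morph J JD J0).
Qed.

Lemma rr_id u : rr idfun u = u.
Proof. by rewrite /rr rho_id JK. Qed.

Lemma rr_sqn_le p u : M p -> is_projection p -> sqn (rr p u) <= sqn u.
Proof.
by move=> Mp hp; rewrite sqn_J -(sqn_J u); apply: proj_sqn_le; exact: rho_projection.
Qed.

Lemma J_xiphi : J xiphi = xiphi.
Proof. by case: hxiphi => Px _; exact: (std_fix hL). Qed.

(** The square of the norm |x|_phi. *)
Definition mass x : R := sqn (rho x xiphi).

Lemma mass_ge0 x : 0 <= mass x. Proof. exact: sqn_ge0. Qed.

Lemma state_adj x y : M x -> M y -> is_adjoint x y ->
  phi (y \o x) = (mass x)%:C.
Proof.
move=> Mx My xy; case: hxiphi => _ ->; last exact: (vna_comp hM).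
rewrite /lact rho_comp// -inner_sqn.
by rewrite (is_adjoint_sym (rho_adjoint Mx My xy)).
Qed.

Lemma state_projection p : M p -> is_projection p -> phi p = (mass p)%:C.
Proof. by move=> Mp [pp ap]; rewrite -(state_adj Mp Mp ap) pp. Qed.

Lemma state_normE x : M x -> state_norm phi x = `|rho x xiphi|.
Proof.
move=> Mx; have [y My xy] := vna_adj hM Mx.
rewrite /state_norm (adj_eq xy) (state_adj Mx My xy) -inner_sqn -inner_norm.
by rewrite sqrCK.
Qed.

Lemma mass_id : mass idfun = 1.
Proof.
have Mi := vna_id hM.
have := state1 hphi; rewrite (@state_projection idfun)//.
by move=> /(congr1 (@complex.Re _)).
Qed.

(** If c bounds the square of the operator norm of x, then c - x^2 is positive
    and so is its state. *)
Lemma mass_le x (c : R) : M x -> is_adjoint x x ->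
  (forall w : K, sqn (x w) <= c * sqn w) -> mass x <= c.
Proof.
move=> Mx ax hx.
have Mi := vna_id hM; have Mxx : M (x \o x) by exact: (vna_comp hM).
have Mci : M (c%:C *: idfun) by exact: (vnaZ hM).
have pos : positive (c%:C *: idfun - (x \o x)).
  move=> u; rewrite opBE opZE linearBl linearZl_LR /= inner_sqn.
  by rewrite ax inner_sqn -rmorphM -rmorphB ler0c subr_ge0.
have := state_ge0 hphi (vnaB hM Mci Mxx) pos.
case: hxiphi => _ ->; last exact: (vnaB hM).
rewrite lecE /= => /andP[_]; rewrite /lact rhoB// rhoZ// rho_id rho_comp//.
rewrite -/(ip _ _) ipBl ipZl (ip_adjoint (rho_adjoint Mx Mx ax)).
rewrite -!/(sqn _) -/(mass x).
have -> : sqn xiphi = 1 by rewrite -mass_id /mass rho_id.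
by rewrite mulr1 subr_ge0.
Qed.

(** Both actions of a self-adjoint x on xi = a xiphi = J b xiphi are controlled
    by |x|_phi, because x can be moved past a or b by commutation. *)
Lemma bounded_vector xi : phi_bounded M rho xiphi xi ->
  phi_bounded M rho xiphi (J xi) ->
  exists2 c : R, 0 <= c & forall x, M x -> is_adjoint x x ->
    sqn (rho x xi) <= c * mass x /\ sqn (rr x xi) <= c * mass x.
Proof.
move=> [a Ma xia] [b Mb xib].
have [ca ca0 ha] := bounded_opP (rho_bounded Ma).
have [cb cb0 hb] := bounded_opP (rho_bounded Mb).
exists (ca + cb); first by rewrite addr_ge0 ?ltW.
have rrphi x : rr x xiphi = J (rho x xiphi) by rewrite /rr J_xiphi.
move=> x Mx ax; rewrite !mulrDl; split.
  have -> : sqn (rho x xi) = sqn (rho b (rr x xiphi)).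
    by rewrite rho_rr// -[rho b xiphi]xib /rr JK sqn_J.
  rewrite -[leLHS]add0r lerD ?(mulr_ge0 (ltW ca0)) ?mass_ge0//.
  by apply: le_trans (hb _) _; rewrite rrphi sqn_J.
have -> : sqn (rr x xi) = sqn (rho a (rr x xiphi)).
  by rewrite rho_rr// -[rho a xiphi]xia.
rewrite -[leLHS]addr0 lerD ?(mulr_ge0 (ltW cb0)) ?mass_ge0//.
by apply: le_trans (ha _) _; rewrite rrphi sqn_J.
Qed.

Lemma bounded_vectors (S : seq L) :
  (forall xi, xi \in S ->
     phi_bounded M rho xiphi xi /\ phi_bounded M rho xiphi (J xi)) ->
  exists2 b : R, 0 <= b & forall x, M x -> is_adjoint x x ->
    \sum_(xi <- S) sqn (rho x xi) <= b * mass x /\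
    \sum_(xi <- S) sqn (rr x xi) <= b * mass x.
Proof.
elim: S => [|xi S IH] hS.
  by exists 0 => // x _ _; rewrite !big_nil mul0r.
have [|b b0 hb] := IH; first by move=> u uS; apply: hS; rewrite inE uS orbT.
have [x1 x2] := hS xi (mem_head _ _).
have [c c0 hc] := bounded_vector x1 x2.
exists (c + b); first exact: addr_ge0.
move=> x Mx ax; have [h1 h2] := hb x Mx ax; have [h3 h4] := hc x Mx ax.
by rewrite !big_cons mulrDl; split; apply: lerD.
Qed.

Lemma commutator_sa x xi : is_adjoint x x ->
  commutator rho J x xi = rho x xi - rr x xi.
Proof. by move=> ax; rewrite /commutator /lact /ract (adj_eq ax). Qed.

Lemma corner_sa p x xi : M p -> is_projection p -> M x -> is_adjoint x x ->
  p \o x = x ->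
  ract rho J (lact rho p (commutator rho J x xi)) p =
  rho x (rr p xi) - rho p (rr x xi).
Proof.
move=> Mp pp Mx ax px.
rewrite commutator_sa// /lact /ract (adj_eq pp.2) -/(rr p _).
rewrite (linB _ _ (rho_linear Mp)) rrBr// -rho_comp// px -rho_rr//.
by rewrite -rho_rr// -rr_comp// px.
Qed.

(** * Step operators and energies *)

(** For self-adjoint x in pMp this is the sum of |p(x xi - xi x)p|^2.  Squared
    norms are used since they add up over orthogonal components. *)
Definition corner_energy (S : seq L) p x : R :=
  \sum_(xi <- S) sqn (rho x (rr p xi) - rho p (rr x xi)).

Lemma corner_energy_ge0 S p x : 0 <= corner_energy S p x.
Proof. by apply: sumr_ge0 => xi _; exact: sqn_ge0. Qed.

Section StepOperators.
Context (n : nat) (r : 'I_n -> K -> K).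
Context (Mr : forall i, M (r i)) (pr : forall i, is_projection (r i)).
Context (r_orth : forall i j, i != j -> forall w, r i (r j w) = 0).
Implicit Types a b : 'I_n -> R.

Definition step_op a : K -> K := \sum_i (a i)%:C *: r i.

Lemma step_opE a w : step_op a w = \sum_i (a i)%:C *: r i w.
Proof. by rewrite /step_op op_sumE. Qed.

Lemma step_op_M a : M (step_op a).
Proof. by apply: (vna_sum hM) => i; exact: (vnaZ hM). Qed.

Lemma step_op_sa a : is_adjoint (step_op a) (step_op a).
Proof.
by apply: is_adjoint_sum => i; apply: is_adjointZr; exact: (pr i).2.
Qed.

Lemma step_op_comp a b : step_op a \o step_op b = step_op (fun i => a i * b i).
Proof.
apply/funext => w /=; rewrite !step_opE; apply: eq_bigr => i _.
have lr := vna_linear hM (Mr i).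
rewrite (lin_sum _ _ _ lr) (bigD1 i)//= big1 => [|j ji].
  by rewrite (linZ _ _ lr) (proj_idem (pr i)) addr0 scalerA rmorphM.
by rewrite (linZ _ _ lr) r_orth ?scaler0// eq_sym.
Qed.

Lemma step_op_projection a : (forall i, a i * a i = a i) ->
  is_projection (step_op a).
Proof.
move=> aa; split; last exact: step_op_sa.
by rewrite step_op_comp; congr step_op; apply/funext => i.
Qed.

Lemma rho_step a u : rho (step_op a) u = \sum_i (a i)%:C *: rho (r i) u.
Proof.
rewrite rho_sum => [|i]; last exact: (vnaZ hM).
by apply: eq_bigr => i _; rewrite rhoZ.
Qed.

Lemma rr_step a u : rr (step_op a) u = \sum_i (a i)%:C *: rr (r i) u.
Proof.
rewrite rr_sum => [|i]; last exact: (vnaZ hM).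
by apply: eq_bigr => i _; rewrite rrZ.
Qed.

Lemma rho_orth i j u : i != j -> rho (r i) (rho (r j) u) = 0.
Proof.
move=> ij; rewrite -rho_comp// (_ : _ \o _ = 0) ?rho0//.
by apply/funext => w /=; rewrite r_orth.
Qed.

Lemma ip_rho_orth i j u v : i != j -> ip (rho (r i) u) (rho (r j) v) = 0.
Proof.
move=> ij; rewrite (ip_adjoint (rho_adjoint (Mr i) (Mr i) (pr i).2)).
by rewrite rho_orth// ip0r.
Qed.

Lemma ip_rr_orth i j u v : i != j -> ip (rr (r i) u) (rr (r j) v) = 0.
Proof. by move=> ij; rewrite ip_J ip_rho_orth. Qed.

Lemma mass_step a : mass (step_op a) = \sum_i a i ^+ 2 * mass (r i).
Proof.
rewrite /mass rho_step pythagoras => [|i j ij].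
  by apply: eq_bigr => i _; rewrite sqnZ.
by rewrite ipZl ipZr ip_rho_orth// !mulr0.
Qed.

(** The components r_i xi r_j are pairwise orthogonal, so the actions of step
    operators are diagonal in them. *)
Definition grid xi i j : R := sqn (rho (r i) (rr (r j) xi)).

Lemma corner_step a b xi :
  sqn (rho (step_op a) (rr (step_op b) xi) - rho (step_op b) (rr (step_op a) xi))
  = \sum_i \sum_j (a i * b j - b i * a j) ^+ 2 * grid xi i j.
Proof.
pose z i j := rho (r i) (rr (r j) xi).
have E c d : rho (step_op c) (rr (step_op d) xi) =
    \sum_i \sum_j (c i * d j)%:C *: z i j.
  rewrite rho_step; apply: eq_bigr => i _.
  rewrite rr_step (lin_sum _ _ _ (rho_linear (Mr i))) scaler_sumr.
  apply: eq_bigr => j _.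
  by rewrite (linZ _ _ (rho_linear (Mr i))) scalerA rmorphM.
rewrite !E -sumrB; under eq_bigr => i _ do rewrite -sumrB.
rewrite pair_big /= pythagoras => [|[i j] [k l] ne].
  rewrite [RHS]pair_big /=; apply: eq_bigr => -[i j] _ /=.
  by rewrite -scalerBl -rmorphB sqnZ.
rewrite /= -!scalerBl -!rmorphB ipZl ipZr.
suff -> : ip (z i j) (z k l) = 0 by rewrite !mulr0.
have [ik|ik] := eqVneq i k; last exact: ip_rho_orth.
rewrite /z !rho_rr// ip_rr_orth//.
by apply: contra_neq ne => ->; rewrite ik.
Qed.

Lemma grid_ge0 xi i j : 0 <= grid xi i j.
Proof. exact: sqn_ge0. Qed.

Lemma grid_row xi i : is_projection (step_op (fun=> 1)) ->
  \sum_j grid xi i j <= sqn (rho (r i) xi).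
Proof.
move=> pp; rewrite -(pythagoras (F := fun j => rho (r i) (rr (r j) xi))).
  rewrite -(lin_sum _ _ _ (rho_linear (Mr i))).
  have <- : rr (step_op (fun=> 1)) xi = \sum_j rr (r j) xi.
    by rewrite rr_step; apply: eq_bigr => j _; rewrite scale1r.
  by rewrite rho_rr ?rr_sqn_le//; exact: step_op_M.
by move=> j k jk; rewrite !rho_rr// ip_rr_orth.
Qed.

Lemma grid_col xi j : is_projection (step_op (fun=> 1)) ->
  \sum_i grid xi i j <= sqn (rr (r j) xi).
Proof.
move=> pp; rewrite -(pythagoras (F := fun i => rho (r i) (rr (r j) xi))).
  have <- : rho (step_op (fun=> 1)) (rr (r j) xi) =
      \sum_i rho (r i) (rr (r j) xi).
    by rewrite rho_step; apply: eq_bigr => i _; rewrite scale1r.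
  apply: proj_sqn_le; apply: rho_projection => //; exact: step_op_M.
by move=> i k ik; rewrite ip_rho_orth.
Qed.

End StepOperators.

(** Cutting q off from 1 - Q adds at most the energy of q inside that corner:
    the components between Q and q disappear. *)
Lemma energy_extend S p q : M p -> is_projection p -> M q -> is_projection q ->
  (forall w, p (q w) = 0) ->
  corner_energy S idfun (p + q) <=
  corner_energy S idfun p + corner_energy S (idfun - p) q.
Proof.
move=> Mp hp Mq hq pq.
have lp := vna_linear hM Mp; have lq := vna_linear hM Mq.
have qp w : q (p w) = 0.
  apply: sqn_eq0; rewrite /sqn (ip_adjoint hq.2) (ip_adjoint hp.2) pq.
  by rewrite ip0r.
have Mi := vna_id hM.
pose r (i : 'I_3) := nth 0 [:: p; q; idfun - p - q] i.
have r0 : r ord0 = p by [].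
have r1 : r (lift ord0 ord0) = q by [].
have r2 : r (lift ord0 (lift ord0 ord0)) = idfun - p - q by [].
have Ms : M (idfun - p - q) by apply: (vnaB hM) => //; exact: (vnaB hM).
have Mr i : M (r i) by case: i => -[|[|[|]]].
have sE w : (idfun - p - q) w = w - p w - q w by [].
have ps w : p ((idfun - p - q) w) = 0.
  by rewrite sE !(linB _ _ lp) pq (proj_idem hp) subrr subr0.
have qs w : q ((idfun - p - q) w) = 0.
  by rewrite sE !(linB _ _ lq) qp (proj_idem hq) subr0 subrr.
have hs : is_projection (idfun - p - q).
  split.
    by apply/funext => w; rewrite [LHS]sE ps qs !subr0.
  apply: is_adjointB; last exact: hq.2.
  by apply: is_adjointB; [exact: is_adjoint_id|exact: hp.2].
have sp w : (idfun - p - q) (p w) = 0 by rewrite sE qp (proj_idem hp) subrr subr0.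
have sq w : (idfun - p - q) (q w) = 0 by rewrite sE pq (proj_idem hq) subr0 subrr.
have pr i : is_projection (r i) by case: i => -[|[|[|]]].
have ro i j : i != j -> forall w, r i (r j w) = 0.
  by case: i j => -[|[|[|]]]// ? [[|[|[|]]]].
(* all operators involved are constant on the three pieces p, q, 1 - p - q *)
pose vec (a b c : R) (i : 'I_3) := nth 0 [:: a; b; c] i.
have stepE a b c : step_op r (vec a b c) =
    a%:C *: p + b%:C *: q + c%:C *: (idfun - p - q).
  by rewrite /step_op !big_ord_recl big_ord0 addr0 addrA.
have pE : p = step_op r (vec 1 0 0).
  by rewrite stepE scale1r !scale0r !addr0.
have qE : q = step_op r (vec 0 1 0).
  by rewrite stepE scale1r !scale0r addr0 add0r.
have pqE : p + q = step_op r (vec 1 1 0).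
  by rewrite stepE !scale1r !scale0r addr0.
have iE : idfun = step_op r (vec 1 1 1).
  by rewrite stepE !scale1r -addrA [q + _]addrC subrK addrC subrK.
have ipE : idfun - p = step_op r (vec 0 1 1).
  by rewrite stepE !scale1r !scale0r add0r [q + _]addrC subrK.
rewrite /corner_energy -big_split /=; apply: ler_sum => xi _.
rewrite pqE ipE iE pE qE !corner_step//.
rewrite !big_ord_recl !big_ord0 /vec /= !addr0.
have g i j := grid_ge0 r xi i j.
rewrite -subr_ge0; set G := grid r xi.
set i0 : 'I_3 := ord0; set i1 : 'I_3 := lift (ord0 : 'I_3) (ord0 : 'I_2).
set i2 : 'I_3 := lift (ord0 : 'I_3) (lift (ord0 : 'I_2) (ord0 : 'I_1)).
rewrite (_ : _ - _ = G i0 i1 + G i1 i0); last by ring.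
by rewrite addr_ge0.
Qed.

(** * Sparse projections in a corner without gap *)

(** The steps are spectral projections of h, hence commute with p, and p can
    be used to compress them. *)
Lemma corner_steps (N : set (K -> K)) p h (eta : R) : von_neumann_algebra N ->
  N p -> is_projection p -> N h -> is_adjoint h h -> p \o h = h -> 0 < eta ->
  exists (n : nat) (t : R) (r : 'I_n -> K -> K),
  [/\ forall i, N (r i), forall i, is_projection (r i),
      forall i j, i != j -> forall w, r i (r j w) = 0,
      step_op r (fun=> 1) = p &
      forall w, sqn (h w - step_op r (fun i => t + i%:R * eta) w)
                <= eta ^+ 2 * sqn w].
Proof.
move=> hN Np hp Nh ah ph eta0.
have hpE : h \o p = h.
  apply: (is_adjoint_uniq (x := h)) => //.
  have := is_adjoint_comp hp.2 ah; by rewrite ph.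
pose C := commutant [set h].
have bC b : C b -> bounded_op b by case.
have Ch : C h by split=> [|x ->//]; exact: (vna_bounded hN).
have Cp : C p.
  by split=> [|x ->]; [exact: (vna_bounded hN)|rewrite hpE ph].
have WC x : commutant C x -> C x.
  by move=> [bx hx]; split=> // y ->; exact: hx.
have WN x : commutant C x -> N x.
  move=> [bx hx]; rewrite -(vna_bicommutant hN); split=> // y [by_ hy].
  by apply: hx; split=> // z ->; exact: hy.
have abW x y : commutant C x -> commutant C y -> forall w, x (y w) = y (x w).
  move=> Wx [_ /(_ x (WC _ Wx)) xy] w.
  exact: (congr1 (@^~ w) xy).
have Wh : commutant C h by split=> [|x [_ /(_ h erefl)] //]; exact: (vna_bounded hN).
have [n [t [s [Ws ps so ss sh]]]] := spectral_steps bC abW Wh ah eta0.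
have sp i w : s i (p w) = p (s i w).
  by have [_ /(_ p Cp) e] := Ws i; exact: (esym (congr1 (@^~ w) e)).
exists n, t, (fun i => s i \o p); split=> [i|i|i j ij w||w].
- by apply: (vna_comp hN) => //; exact: WN.
- split; first by apply/funext => w /=; rewrite sp (proj_idem (ps i)) -sp (proj_idem hp).
  rewrite -[X in is_adjoint X _](_ : p \o s i = _); last first.
    by apply/funext => w /=; rewrite sp.
  by apply: is_adjoint_comp; [exact: hp.2|exact: (ps i).2].
- by rewrite /= -sp so.
- apply/funext => w; rewrite step_opE -[RHS]ss; apply: eq_bigr => i _.
  by rewrite scale1r.
have -> : h w = h (p w) by exact: (esym (congr1 (@^~ w) hpE)).
rewrite step_opE; apply: le_trans (sh (p w)) _.
by rewrite ler_wpM2l ?sqr_ge0// proj_sqn_le.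
Qed.

Section SparseCorner.
Context (N : set (K -> K)) (hN : von_neumann_algebra N) (hNM : N `<=` M).
Context (S : seq L) (b : R) (b0 : 0 <= b).
Context (hb : forall x, M x -> is_adjoint x x ->
  \sum_(xi <- S) sqn (rho x xi) <= b * mass x /\
  \sum_(xi <- S) sqn (rr x xi) <= b * mass x).

(** The weight t > 0 is free so that the energy of a limit of projections can be
    compared with the energies of its approximants without losing a factor. *)
Lemma corner_energy_perturb p x g (t : R) : M p -> is_projection p -> M x -> M g ->
  is_adjoint g g -> 0 < t ->
  corner_energy S p (x - g) <=
  (1 + t) * corner_energy S p x + (1 + t^-1) * (4 * b * mass g).
Proof.
move=> Mp hp Mx Mg ag t0; have [b1 b2] := hb Mg ag.
have t1 : 0 <= 1 + t^-1 by rewrite addr_ge0// invr_ge0 ltW.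
apply: (@le_trans _ _ (\sum_(xi <- S)
   ((1 + t) * sqn (rho x (rr p xi) - rho p (rr x xi))
   + (1 + t^-1) * (2 * sqn (rho g xi) + 2 * sqn (rr g xi))))).
  apply: ler_sum => xi _; rewrite rhoB// rrB// (linB _ _ (rho_linear Mp)).
  set a := rho x _; set c := rho p _; set d := rho g _; set e := rho p _.
  rewrite (_ : a - d - (c - e) = (a - c) - (d - e)); last first.
    by rewrite !opprB [e - c]addrC addrACA [- d + e]addrC.
  apply: le_trans (sqnB_le_weighted _ _ t0) _; rewrite lerD2l ler_wpM2l//.
  have := sqnB_le d e.
  have : sqn d <= sqn (rho g xi) by rewrite /d rho_rr// rr_sqn_le.
  have : sqn e <= sqn (rr g xi).
    by apply: proj_sqn_le; exact: rho_projection.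
  by lra.
rewrite big_split /= -!mulr_sumr -/(corner_energy _ _ _) lerD2l ler_wpM2l//.
by rewrite big_split /= -!mulr_sumr; lra.
Qed.

(** A self-adjoint h with small commutators relative to its size is replaced
    by a projection with the same property: h is first replaced by a step
    operator, and the level sets of a step operator are handled by
    [sparse_cut]. *)
Lemma sparse_corner_projection (delta : R) : 0 < delta ->
  exists2 theta : R, 0 < theta & forall p h,
    N p -> is_projection p -> N h -> is_adjoint h h -> p \o h = h ->
    ip (rho h xiphi) xiphi = 0 -> 0 < mass h ->
    corner_energy S p h <= theta * mass h ->
    exists q, [/\ N q, is_projection q, p \o q = q &
      [/\ 0 < mass q, 2 * mass q <= mass p &
          corner_energy S p q <= delta * mass q]].
Proof.
(* gamma is the admissible ratio of energy to variance.  Passing from h to the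
   step operator costs eta^2 = theta H in mass and a multiple of it in energy,
   and the factor 8 + 32 b collects these losses. *)
move=> d0; have [gamma g0 cutP] := sparse_cut b0 d0.
have b0' := b0.
have b8 : 0 < 8 + 32 * b by lra.
pose theta := Num.min 4^-1 (gamma / (8 + 32 * b)).
have t0 : 0 < theta by rewrite lt_min divr_gt0// andbT invr_gt0 ltr0n.
have t4 : theta <= 4^-1 by rewrite ge_min lexx.
have tg : theta * (8 + 32 * b) <= gamma by rewrite -ler_pdivlMr// ge_min lexx orbT.
clearbody theta; exists theta => // p h Np hp Nh ah ph hphi0 H0 hE.
set H := mass h in H0 hE.
pose eta := Num.sqrt (theta * H).
have eta0 : 0 < eta by rewrite sqrtr_gt0 mulr_gt0.
have eta2 : eta ^+ 2 = theta * H by rewrite sqr_sqrtr// ltW// mulr_gt0.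
have e20 : 0 < eta ^+ 2 by rewrite exprn_gt0.
have [n [t [r [Nr pr ro rp hr]]]] := corner_steps hN Np hp Nh ah ph eta0.
have Mr i : M (r i) by exact: hNM.
have Mp := hNM Np; have Mh := hNM Nh.
pose lev (i : 'I_n) : R := t + i%:R * eta.
pose g := h - step_op r lev.
have Ms a : M (step_op r a) by exact: step_op_M.
have Mg : M g by exact: (vnaB hM).
have ag : is_adjoint g g by apply: is_adjointB => //; exact: step_op_sa.
have mg : mass g <= theta * H.
  by rewrite -eta2; apply: mass_le => // w; exact: hr.
have sE : step_op r lev = h - g by rewrite /g opprB addrC subrK.
have p1 : is_projection (step_op r (fun=> 1)) by rewrite rp.
have v0 i : 0 <= mass (r i) by exact: mass_ge0.
pose w i j := \sum_(xi <- S) grid r xi i j.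
have w0 i j : 0 <= w i j by apply: sumr_ge0 => xi _; exact: grid_ge0.
have wr i : \sum_j w i j <= b * mass (r i).
  rewrite exchange_big /=; apply: le_trans (hb (Mr i) (pr i).2).1.
  by apply: ler_sum => xi _; exact: grid_row.
have wc j : \sum_i w i j <= b * mass (r j).
  rewrite exchange_big /=; apply: le_trans (hb (Mr j) (pr j).2).2.
  by apply: ler_sum => xi _; exact: grid_col.
have energyE a : corner_energy S p (step_op r a) =
    \sum_i \sum_j (a i - a j) ^+ 2 * w i j.
  rewrite /corner_energy -rp.
  under eq_bigr => xi _ do rewrite corner_step//.
  rewrite exchange_big /=; apply: eq_bigr => i _.
  rewrite exchange_big /=; apply: eq_bigr => j _.
  by rewrite -mulr_sumr mulr1 mul1r.
(* phi(h) = 0 makes h orthogonal to p, so subtracting a multiple of p cannot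
   decrease the norm *)
have var (m : nat) : H / 4 <= eta ^+ 2 * \sum_(i < n) (i%:R - m%:R) ^+ 2 * mass (r i).
  pose c := t + m%:R * eta.
  pose a (i : 'I_n) : R := (i%:R - m%:R) * eta.
  have -> : eta ^+ 2 * \sum_(i < n) (i%:R - m%:R) ^+ 2 * mass (r i) =
      mass (step_op r a).
    rewrite mass_step// mulr_sumr; apply: eq_bigr => i _.
    by rewrite /a exprMn; ring.
  have aE : step_op r a = step_op r lev - c%:C *: p.
    apply/funext => z; rewrite -rp opBE opZE !step_opE scaler_sumr -sumrB.
    apply: eq_bigr => i _; rewrite scalerA -scalerBl -rmorphM -rmorphB.
    by congr (_%:C *: _); rewrite /a /lev /c; ring.
  have := sqnD_le (rho (step_op r a) xiphi) (rho g xiphi).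
  rewrite -/(mass g) -/(mass (step_op r a)).
  rewrite -rhoD// aE sE (_ : h - g - c%:C *: p + g = h - c%:C *: p); last first.
    by rewrite addrAC subrK.
  rewrite rhoB//; last exact: (vnaZ hM).
  rewrite rhoZ// sqnB ipZr -/(mass h) -/H.
  have -> : ip (rho h xiphi) (rho p xiphi) = 0.
    rewrite -(ip_adjoint (rho_adjoint Mp Mp hp.2)) -rho_comp// ph.
    exact: hphi0.
  rewrite sqnZ; have := sqn_ge0 (rho p xiphi); have := sqr_ge0 c.
  move: (c ^+ 2) (sqn _) (mass _) => c2 m1 m2 c20 m10.
  have : 0 <= c2 * m1 by rewrite mulr_ge0.
  by nra.
have ene : eta ^+ 2 * \sum_(i < n) \sum_(j < n) (i%:R - j%:R) ^+ 2 * w i j <=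
    (2 + 8 * b) * theta * H.
  have -> : eta ^+ 2 * \sum_(i < n) \sum_(j < n) (i%:R - j%:R) ^+ 2 * w i j =
      corner_energy S p (h - g).
    rewrite -sE energyE mulr_sumr; apply: eq_bigr => i _.
    rewrite mulr_sumr; apply: eq_bigr => j _.
    by rewrite /lev; ring.
  apply: le_trans (corner_energy_perturb Mp hp Mh Mg ag ltr01) _; rewrite invr1.
  have : 8 * b * mass g <= 8 * b * (theta * H).
    by rewrite ler_wpM2l// mulr_ge0.
  by lra.
have [||A [A0 A1 A2]] := cutP n _ w v0 w0 wr wc.
- move=> m; rewrite -(pmulr_rgt0 _ e20); apply: lt_le_trans (var m).
  by rewrite divr_gt0.
- move=> m; rewrite -(ler_pM2l e20); apply: le_trans ene _.
  rewrite mulrCA; apply: le_trans (_ : gamma * (H / 4) <= _); last first.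
    by rewrite ler_wpM2l ?(ltW g0).
  have -> : (2 + 8 * b) * theta * H = theta * (8 + 32 * b) * (H / 4) by field.
  by rewrite ler_wpM2r// divr_ge0 ?(ltW H0).
pose a (i : 'I_n) : R := (A i)%:R.
have mq : mass (step_op r a) = \sum_(i | A i) mass (r i).
  rewrite mass_step// [RHS]big_mkcond; apply: eq_bigr => i _.
  by rewrite /a; case: (A i); rewrite ?expr1n ?mul1r// expr0n mul0r.
have mp : mass p = \sum_i mass (r i).
  by rewrite -rp mass_step//; apply: eq_bigr => i _; rewrite expr1n mul1r.
exists (step_op r a); split.
- by apply: (vna_sum hN) => i; exact: (vnaZ hN).
- apply: step_op_projection => // i.
  by rewrite /a; case: (A i); rewrite ?mul1r ?mul0r.
- rewrite -rp step_op_comp//; congr step_op; apply/funext => i.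
  by rewrite mul1r.
rewrite mq mp; split=> //; rewrite energyE.
rewrite (eq_bigr (fun i => \sum_j (A i != A j)%:R * w i j))// => i _.
apply: eq_bigr => j _; congr (_ * _).
by rewrite /a; case: (A i); case: (A j);
  rewrite /= ?subrr ?subr0 ?sub0r ?sqrrN ?expr1n ?expr0n.
Qed.

End SparseCorner.

(** * Reduction to self-adjoint elements *)

Lemma sum_le_size (T : eqType) (s : seq T) (F : T -> R) (c : R) :
  (forall a, a \in s -> F a <= c) -> \sum_(a <- s) F a <= (size s)%:R * c.
Proof.
move=> h; rewrite big_seq; apply: (@le_trans _ _ (\sum_(a <- s | a \in s) c)).
  exact: ler_sum.
by rewrite -big_seq big_const_seq count_predT iter_addr_0 mulr_natl.
Qed.

Section SelfAdjointReduction.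
Context (Sigma : set L) (N : set (K -> K)).
Context (hN : von_neumann_algebra N) (hNM : N `<=` M).
Context (p : K -> K) (Np : N p) (hp : is_projection p).

(** p (x xi - xi x) p, where y stands for the adjoint of x. *)
Definition corner_commutator x y xi :=
  rr p (rho p (rho x xi - J (rho y (J xi)))).

Lemma corner_commutatorE x y xi : is_adjoint x y ->
  ract rho J (lact rho p (commutator rho J x xi)) p = corner_commutator x y xi.
Proof.
move=> xy; rewrite /ract /lact /commutator (adj_eq hp.2) /ract (adj_eq xy).
by [].
Qed.

Lemma corner_commutator_adj x y xi : M x -> M y ->
  corner_commutator y x xi = - J (corner_commutator x y (J xi)).
Proof.
move=> Mx My; have Mp := hNM Np; rewrite /corner_commutator.
have Jrr w : J (rr p w) = rho p (J w) by rewrite /rr JK.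
have Jrho w : J (rho p w) = rr p (J w) by rewrite /rr JK.
rewrite Jrr Jrho rho_rr// -rrNr// -(linN _ (rho_linear Mp)).
by rewrite JB !JK opprB.
Qed.

Lemma corner_commutatorD x y x' y' xi : M x -> M y -> M x' -> M y' ->
  corner_commutator (x + x') (y + y') xi =
  corner_commutator x y xi + corner_commutator x' y' xi.
Proof.
move=> Mx My Mx' My'; have Mp := hNM Np; rewrite /corner_commutator.
rewrite -rrDr// -(linD _ _ (rho_linear Mp)) !rhoD// JD.
by rewrite opprD addrACA.
Qed.

Lemma corner_commutatorZ (a : R[i]) x y xi : M x -> M y ->
  corner_commutator (a *: x) (Num.conj a *: y) xi = a *: corner_commutator x y xi.
Proof.
move=> Mx My; have Mp := hNM Np; rewrite /corner_commutator !rhoZ// JZ conjCK.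
by rewrite -scalerBr (linZ _ _ (rho_linear Mp)) rrZr.
Qed.

Lemma corner_commutator_sa x xi : M x -> is_adjoint x x -> p \o x = x ->
  corner_commutator x x xi = rho x (rr p xi) - rho p (rr x xi).
Proof.
by move=> Mx ax px; rewrite -corner_commutatorE// corner_sa//; exact: hNM.
Qed.

Lemma sqn_i u : sqn ('i%C *: u) = sqn u.
Proof.
rewrite !sqnE normrZ; congr (complex.Re (_ ) ^+ 2).
by rewrite normc_def /= expr0n expr1n add0r sqrtr1 mul1r.
Qed.

Context (S : {fset L}) (theta : R).
Context (SJ : forall xi, xi \in S -> J xi \in S) (theta0 : 0 < theta).
Context (hgap : forall h, N h -> is_adjoint h h -> p \o h = h ->
  ip (rho h xiphi) xiphi = 0 -> theta * mass h <= corner_energy S p h).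

Lemma real_part_mass x y (T : R) : N x -> N y -> is_adjoint x y ->
  p \o x = x -> p \o y = y -> ip (rho x xiphi) xiphi = 0 ->
  (forall xi, xi \in S -> sqn (corner_commutator x y xi) <= T) ->
  theta * mass ((2^-1)%:C *: (x + y)) <= (size S)%:R * T.
Proof.
move=> Nx Ny xy px py x0 hT.
have Mx := hNM Nx; have My := hNM Ny.
have yx := is_adjoint_sym xy.
set a := _ *: _.
have Na : N a by apply: (vnaZ hN); exact: (vnaD hN).
have aa : is_adjoint a a.
  by apply: is_adjointZr; rewrite {2}addrC; exact: is_adjointD.
have lp := vna_linear hN Np.
have pa : p \o a = a.
  apply/funext => w; rewrite /= /a opZE opDE (linZ _ _ lp) (linD _ _ lp).
  have e1 := congr1 (@^~ w) px; have e2 := congr1 (@^~ w) py.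
  by rewrite /= in e1 e2; rewrite e1 e2.
have a0 : ip (rho a xiphi) xiphi = 0.
  rewrite /a rhoZ; last exact: (vnaD hM).
  rewrite rhoD// ipZl ipDl x0 (ip_adjoint (rho_adjoint My Mx yx)) ipC x0.
  by rewrite addr0 mulr0.
apply: le_trans (hgap Na aa pa a0) _.
apply: sum_le_size => xi xiS; rewrite -corner_commutator_sa//; last exact: hNM.
have -> : corner_commutator a a xi = (2^-1)%:C *:
    (corner_commutator x y xi + corner_commutator y x xi).
  rewrite -corner_commutatorD// [y + x]addrC.
  rewrite -corner_commutatorZ ?conj_real//; exact: (vnaD hM).
rewrite sqnZ (corner_commutator_adj xi Mx My).
have := sqnD_le (corner_commutator x y xi) (- J (corner_commutator x y (J xi))).
rewrite sqnN sqn_J; have := hT _ xiS; have := hT _ (SJ xiS).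
by lra.
Qed.

(** A gap for self-adjoint elements gives one for all elements: split x into
    real and imaginary parts.  Taking the adjoint of x amounts to replacing xi
    by J xi, which is why S has to be stable under J. *)
Lemma gap_of_self_adjoint : p <> 0 -> [set` S] `<=` Sigma ->
  exists kappa : R, corner_gap rho J phi N Sigma p S kappa.
Proof.
move=> p0 SS; pose n : R := (size S)%:R.
have n0 : 0 <= n by exact: ler0n.
pose k0 := 4 * n / theta; have k00 : 0 <= k0.
  by rewrite divr_ge0 ?(ltW theta0)// mulr_ge0.
exists (1 + k0); split=> //; first by lra.
move=> x [z Nz xE] phix.
have Nx : N x by rewrite xE; apply: (vna_comp hN) => //; exact: (vna_comp hN).
have Mx := hNM Nx.
have [y Ny xy] := vna_adj hN Nx; have My := hNM Ny.
have px : p \o x = x by rewrite xE; apply/funext => w /=; rewrite (proj_idem hp).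
have xp : x \o p = x by rewrite xE; apply/funext => w /=; rewrite (proj_idem hp).
have py : p \o y = y.
  apply: (is_adjoint_uniq (x := x)) => //.
  by have := is_adjoint_comp xy hp.2; rewrite xp.
have lp := vna_linear hN Np.
have x0 : '[rho x xiphi, xiphi] = 0.
  by case: hxiphi => _ /(_ _ Mx) <-.
rewrite state_normE//.
under eq_bigr => xi _ do rewrite (corner_commutatorE xi xy) norm_real.
rewrite norm_real -rmorph_sum -rmorphM lecR.
set tau := \sum_(xi <- S) _.
have tau0 : 0 <= tau by apply: sumr_ge0 => xi _; exact: Re_norm_ge0.
have hT xi : xi \in S -> sqn (corner_commutator x y xi) <= tau ^+ 2.
  move=> xiS; rewrite sqnE ler_pXn2r ?nnegrE ?Re_norm_ge0//.
  rewrite /tau (big_rem xi)//= lerDl.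
  by apply: sumr_ge0 => u _; exact: Re_norm_ge0.
have ha := real_part_mass Nx Ny xy px py (congr1 (@complex.Re _) x0) hT.
(* the imaginary part of x is the real part of - i x *)
pose x' := - 'i%C *: x; pose y' := 'i%C *: y.
have conjNi : Num.conj (- 'i%C : R[i]) = 'i%C.
  by apply/eqP; rewrite eq_complex /= oppr0 opprK !eqxx.
have x'y' : is_adjoint x' y' by rewrite /y' -conjNi; exact: is_adjointZ.
have pZ (a : R[i]) (f : K -> K) : p \o f = f -> p \o (a *: f) = a *: f.
  move=> pv; apply/funext => w; rewrite /= opZE (linZ _ _ lp).
  by have /= -> := congr1 (@^~ w) pv.
have hb : theta * mass ((2^-1)%:C *: (x' + y')) <= (size S)%:R * tau ^+ 2.
  apply: real_part_mass => //; try exact: (vnaZ hN); try exact: pZ.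
    by rewrite /ip /x' rhoZ// linearZl_LR /= x0 mulr0.
  move=> xi xiS.
  have -> : corner_commutator x' y' xi = - 'i%C *: corner_commutator x y xi.
    by rewrite -corner_commutatorZ// conjNi.
  by rewrite scaleNr sqnN sqn_i; exact: hT.
have xE2 : rho x xiphi = rho ((2^-1)%:C *: (x + y)) xiphi +
    'i%C *: rho ((2^-1)%:C *: (x' + y')) xiphi.
  have Mx' : M x' by exact: (vnaZ hM).
  have My' : M y' by exact: (vnaZ hM).
  rewrite !rhoZ ?rhoD//; try exact: (vnaD hM).
  rewrite /x' /y' !rhoZ// scalerA mulrC -scalerA -scalerDr.
  rewrite [X in _ + X]scalerDr !scalerA mulrN -expr2 sqr_i opprK scale1r scaleN1r.
  rewrite addrACA subrr addr0 -[X in X + X]scale1r -scalerDl scalerA.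
  have two : 1 + 1 = (2 : R)%:C :> R[i] by rewrite -[2]/(1 + 1) rmorphD rmorph1.
  by rewrite two -rmorphM mulVf ?scale1r// pnatr_eq0.
have := sqnD_le (rho ((2^-1)%:C *: (x + y)) xiphi)
  ('i%C *: rho ((2^-1)%:C *: (x' + y')) xiphi).
rewrite -xE2 sqn_i -/(mass _) -/(mass _) -/(mass _) => hx.
rewrite -(@ler_pXn2r _ 2)// ?nnegrE ?Re_norm_ge0 ?mulr_ge0//; last by lra.
rewrite -sqnE -/(mass x) exprMn.
have t2 : 0 <= tau ^+ 2 by rewrite sqr_ge0.
apply: le_trans (_ : k0 * tau ^+ 2 <= _); last first.
  by rewrite ler_wpM2r//; nra.
rewrite /k0 mulrAC ler_pdivlMr// mulrC.
apply: le_trans (ler_wpM2l (ltW theta0) hx) _.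
by rewrite /n; lra.
Qed.

End SelfAdjointReduction.

(** * Projections with small commutators *)

Lemma mass_le1 p : M p -> is_projection p -> mass p <= 1.
Proof.
move=> Mp hp; rewrite -mass_id {2}/mass rho_id; apply: proj_sqn_le.
exact: rho_projection.
Qed.

Lemma massB p q : M p -> M q -> is_projection p -> is_projection q ->
  (forall w, q (p w) = p w) -> mass (q - p) = mass q - mass p.
Proof.
move=> Mp Mq hp hq qp; rewrite /mass rhoB//.
apply: proj_sqnB; try exact: rho_projection.
by move=> u; rewrite -rho_comp//; congr (rho _ _); apply/funext.
Qed.

Lemma mass_compl p : M p -> is_projection p -> mass (idfun - p) = 1 - mass p.
Proof. by move=> Mp hp; rewrite massB ?mass_id//; exact: vna_id. Qed.

(** Normality of the state turns the strong convergence on K to the supremum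
    into convergence in the norm |.|_phi, since phi(q - s_n) = |q - s_n|_phi^2. *)
Lemma projection_sup (N : set (K -> K)) (s : nat -> K -> K) :
  von_neumann_algebra N -> N `<=` M ->
  (forall n, N (s n)) -> (forall n, is_projection (s n)) ->
  (forall n w, s n.+1 (s n w) = s n w) ->
  exists q, [/\ N q, is_projection q, forall n w, q (s n w) = s n w &
    forall e : R, 0 < e -> exists n, mass (q - s n) < e].
Proof.
move=> hN NM Ns hs sS.
have Ms n : M (s n) by exact: NM.
have smono n m : (n <= m)%N -> forall w, s m (s n w) = s n w.
  move=> /subnK <-; elim: (m - n)%N => [|k IH] w; first by rewrite proj_idem.
  by rewrite -{1}IH addSn sS IH.
have bN x : commutant N x -> bounded_op x by case.
have Ns' n : commutant (commutant N) (s n) by rewrite (vna_bicommutant hN).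
have [|q [Nq q1 aq sq]] :=
    strong_limit bN Ns' (fun n => proj_sqn_le (hs n)) (fun n => (hs n).2).
  move=> u; exists (fun n => sqn (s n u)), (sqn u); split.
    by move=> m n nm; rewrite proj_sqnB//; exact: smono.
  by move=> n; exact: proj_sqn_le.
rewrite (vna_bicommutant hN) in Nq.
have qs n w : q (s n w) = s n w.
  apply: (norm_cvg_unique (sq (s n w))).
  apply/cvg_sqnP => e e0; exists n => m nm; rewrite smono// subrr sqn0.
  by [].
have [_ cq] := vna_bounded hN Nq.
have hq : is_projection q.
  split=> //; apply/funext => w /=.
  have c1 : (fun n => s n w) @ \oo --> q (q w).
    rewrite (_ : (fun n => s n w) = (fun n => q (s n w))); last first.
      by apply/funext => n; rewrite qs.
    by apply: continuous_cvg; [exact: cq|exact: sq].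
  exact: norm_cvg_unique c1 (sq w).
exists q; split=> //.
have Mq := NM _ Nq.
have dir : directed (fun i j : nat => (i <= j)%N).
  split=> //; first exact: (inhabits 0%N).
    by move=> j i k; exact: leq_trans.
  by move=> i j; exists (maxn i j); rewrite ?leq_maxl ?leq_maxr.
have sup : is_sup M s q.
  split=> //.
    by move=> n; apply: proj_positive; apply: proj_diff => //; exact: (vna_linear hM).
  move=> z Mz hz u.
  have zs n : complex.Im '[z u, u] = 0 /\ sqn (s n u) <= complex.Re '[z u, u].
    have := hz n u; rewrite opBE linearBl /=.
    have -> : '[s n u, u] = (sqn (s n u))%:C.
      by rewrite -(proj_idem (hs n)) (hs n).2 inner_sqn (proj_idem (hs n)).
    rewrite lecE; case: '[z u, u] => a b /=; rewrite subr0 subr_ge0.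
    by move=> /andP[/eqP -> ->].
  rewrite opBE linearBl /=.
  have -> : '[q u, u] = (sqn (q u))%:C.
    by rewrite -(proj_idem hq) hq.2 inner_sqn (proj_idem hq).
  have : sqn (q u) <= complex.Re '[z u, u].
    apply: (ler_cvg_to (cvg_sqn (sq u)) (cvg_cst (complex.Re '[z u, u]))).
    by apply: nearW => n; case: (zs n).
  rewrite lecE; have [] := zs 0%N; case: '[z u, u] => a b /= -> _.
  by rewrite subr0 eqxx subr_ge0.
have spos n : M (s n) /\ positive (s n) by split=> //; exact: proj_positive.
have smon i j : (i <= j)%N -> op_le (s i) (s j).
  move=> ij; apply: proj_positive; apply: proj_diff => //; try exact: (vna_linear hM).
  exact: smono.
have := state_normal hphi dir spos smon sup.
move=> lim e e0.
have := lim (ball (phi q : R[i]^o) e%:C) (nbhsx_ballx _ _ _).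
rewrite ltcR => /(_ e0)[n hn]; exists n.
have := hn n (leqnn n); rewrite /= -ball_normE /ball_ /=.
rewrite !state_projection// -rmorphB massB//.
rewrite normc_def /= expr0n addr0 sqrtr_sqr ltcR.
by apply: le_lt_trans; exact: ler_norm.
Qed.

Section SmallCommutators.
Context (N : set (K -> K)) (hN : von_neumann_algebra N) (hNM : N `<=` M).
Context (S : seq L) (b : R) (b0 : 0 <= b).
Context (hb : forall x, M x -> is_adjoint x x ->
  \sum_(xi <- S) sqn (rho x xi) <= b * mass x /\
  \sum_(xi <- S) sqn (rr x xi) <= b * mass x).

(** The projections whose energy is at most delta times their mass are closed
    under suprema.  A maximal one of mass below eps could be enlarged inside its
    complement, where there is no gap; so some step crosses eps, and as it at
    most halves the complement it stays away from 1. *)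
Lemma small_commutator_projection (eps delta : R) :
  0 < eps -> eps < 1 -> 0 < delta ->
  (forall p (theta : R), N p -> is_projection p -> mass (idfun - p) < eps ->
    0 < theta -> exists h, [/\ N h, is_adjoint h h, p \o h = h,
      ip (rho h xiphi) xiphi = 0 & corner_energy S p h < theta * mass h]) ->
  exists q, [/\ N q, is_projection q, corner_energy S idfun q <= delta,
    eps <= mass q & mass q <= (1 + eps) / 2].
Proof.
move=> eps0 eps1 d0 nogap; apply: contrapT => hno.
have [theta t0 sparse] := sparse_corner_projection hN hNM b0 hb d0.
pose D := [set q | [/\ N q, is_projection q,
  corner_energy S idfun q <= delta * mass q & mass q < eps]].
have good q : N q -> is_projection q -> corner_energy S idfun q <= delta * mass q ->
    mass q <= (1 + eps) / 2 -> D q.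
  move=> Nq hq Eq mq; split=> //; rewrite ltNge; apply/negP => eq.
  apply: hno; exists q; split=> //; apply: le_trans Eq _.
  by rewrite -[leRHS]mulr1 ler_wpM2l ?(ltW d0)// mass_le1//; exact: hNM.
have Mi := vna_id hM.
pose le (p q : K -> K) := forall w, q (p w) = p w.
have D0 : D 0.
  have e0 : mass 0 = 0 by rewrite /mass rho0 sqn0.
  split; first exact: (vna0 hN).
  - by split=> //; exact: is_adjoint0.
  - rewrite e0 mulr0 /corner_energy big1// => xi _.
    by rewrite /rr !rho0 J0 (lin0 (rho_linear Mi)) subrr sqn0.
  - by rewrite e0.
have lexx_ q : D q -> le q q by move=> [_ hq _ _] w; exact: proj_idem.
have [|||s Ds les|q Dq qmax] := @maximal_element R _ D le mass 1 0 D0 lexx_.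
- by move=> p q r pq qr w; rewrite -(pq w) qr.
- move=> p q [Np hp _ _] [Nq hq _ _] pq.
  by have := massB (hNM Np) (hNM Nq) hp hq pq; have := mass_ge0 (q - p); lra.
- by move=> q [Nq hq _ _]; apply: mass_le1 => //; exact: hNM.
- have Ns n : N (s n) by case: (Ds n).
  have hs n : is_projection (s n) by case: (Ds n).
  have [q [Nq hq qs conv]] := projection_sup hN hNM Ns hs les.
  have Mq := hNM Nq; have Ms n := hNM (Ns n).
  have mqs n : mass (q - s n) = mass q - mass (s n) by exact: massB.
  suff Dq : D q by exists q.
  apply: good => //.
    rewrite leNgt; apply/negP => lt1.
    pose gap := corner_energy S idfun q - delta * mass q.
    have gap0 : 0 < gap by rewrite subr_gt0.
    have mq1 : mass q <= 1 by exact: mass_le1.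
    have mq0 := mass_ge0 q.
    have idp : is_projection (@idfun K) by split.
    (* perturbing with weight t costs t delta = gap/2, and the approximation
       costs less than the other half *)
    pose t := gap / (2 * delta).
    have tp : 0 < t by rewrite divr_gt0// mulr_gt0.
    have td : t * delta = gap / 2 by rewrite /t; field; rewrite gt_eqF.
    pose c := (1 + t^-1) * (4 * b).
    have c0 : 0 <= c by rewrite mulr_ge0 ?addr_ge0 ?invr_ge0 ?(ltW tp)// mulr_ge0.
    have e0 : 0 < gap / (2 * (c + 1)) by rewrite divr_gt0// mulr_gt0//; lra.
    have [n hn] := conv _ e0.
    have ag : is_adjoint (s n - q) (s n - q).
      by apply: is_adjointB; [exact: (hs n).2|exact: hq.2].
    have := corner_energy_perturb hb Mi idp (Ms n) (vnaB hM (Ms n) Mq) ag tp.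
    rewrite (_ : s n - (s n - q) = q); last by rewrite opprB addrC subrK.
    have -> : mass (s n - q) = mass (q - s n).
      rewrite /mass !rhoB// -sqnN opprB; congr sqn.
    have [_ _ Esn _] := Ds n => h.
    have h1 : (1 + t) * corner_energy S idfun (s n) <= (1 + t) * (delta * mass (s n)).
      by rewrite ler_wpM2l// addr_ge0// ltW.
    have h2 : c * mass (q - s n) < gap / 2.
      have c1 : 0 < 2 * (c + 1) by rewrite mulr_gt0//; lra.
      move: hn; rewrite ltr_pdivlMr// => hn.
      have := mass_ge0 (q - s n); move: hn; rewrite mulrCA mulrDr mulr1.
      by rewrite [mass _ * c]mulrC; lra.
    have h3 : mass (s n) <= mass q by have := mass_ge0 (q - s n); rewrite mqs; lra.
    have h4 : (1 + t) * (delta * mass (s n)) <= delta * mass q + gap / 2.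
      rewrite mulrDl mul1r mulrA td lerD ?ler_wpM2l ?(ltW d0)//.
      by rewrite ler_piMr ?divr_ge0 ?(ltW gap0)// (le_trans h3).
    have h5 : (1 + t^-1) * (4 * b * mass (q - s n)) = c * mass (q - s n).
      by rewrite /c !mulrA.
    by rewrite h5 in h; rewrite /gap in h2 h4; lra.
  rewrite leNgt; apply/negP => lt1.
  have e0 : 0 < mass q - (1 + eps) / 2 by rewrite subr_gt0.
  have [n hn] := conv _ e0; have [_ _ _ sn] := Ds n.
  by rewrite mqs in hn; lra.
have [Nq hq Eq mq] := Dq; have Mq := hNM Nq.
have lq := vna_linear hN Nq.
have Np : N (idfun - q) by apply: (vnaB hN) => //; exact: vna_id.
have hp : is_projection (idfun - q) by exact: proj_compl.
have mp := mass_compl Mq hq.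
have [h [Nh ah ph h0 hE]] : exists h, [/\ N h, is_adjoint h h,
    (idfun - q) \o h = h, ip (rho h xiphi) xiphi = 0 &
    corner_energy S (idfun - q) h < theta * mass h].
  apply: nogap => //.
  by rewrite (_ : idfun - (idfun - q) = q)// opprB addrC subrK.
have H0 : 0 < mass h.
  by rewrite -(pmulr_rgt0 _ t0); apply: le_lt_trans hE; exact: corner_energy_ge0.
have [r [Nr hr pr [r0 r2 rE]]] :=
  sparse _ _ Np hp Nh ah ph h0 H0 (ltW hE).
have Mr := hNM Nr; have lr := vna_linear hN Nr.
have qr w : q (r w) = 0.
  have := congr1 (@^~ w) pr; rewrite /= opBE => /eqP.
  by rewrite subr_eq addrC eq_sym -subr_eq0 addrK => /eqP.
have Nqr : N (q + r) by exact: (vnaD hN).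
have hqr : is_projection (q + r) by exact: proj_sum.
have qqr w : (q + r) (q w) = q w.
  rewrite opDE (proj_idem hq).
  suff -> : r (q w) = 0 by rewrite addr0.
  by apply: sqn_eq0; rewrite /sqn (ip_adjoint hr.2) (ip_adjoint hq.2) qr ip0r.
have mqr : mass (q + r) = mass q + mass r.
  have := massB Mq (hNM Nqr) hq hqr qqr.
  rewrite (_ : q + r - q = r); last by rewrite addrC addKr.
  by lra.
have Dqr : D (q + r).
  apply: good => //.
    apply: le_trans (energy_extend S Mq hq Mr hr qr) _.
    by rewrite mqr mulrDr lerD.
  by rewrite mqr; rewrite mp in r2; lra.
by have := qmax _ Dqr qqr; rewrite mqr; lra.
Qed.

End SmallCommutators.

End StandardFormCalculus.

(** * The spectral gap theorem *)

Theorem theorem2p1 (R : realType) (K L : hilbertType R)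
  (M : set (K -> K)) (hM : von_neumann_algebra M)
  (phi : (K -> K) -> R[i]) (hphi : faithful_normal_state M phi)
  (rho : (K -> K) -> L -> L) (J : L -> L) (P : set L)
  (hL : standard_form M rho J P)
  (xiphi : L) (hxiphi : state_vector M rho P phi xiphi)
  (N : set (K -> K)) (hN : von_neumann_algebra N) (hNM : N `<=` M)
  (Sigma : set L) (hJSigma : J @` Sigma = Sigma)
  (hbSigma : forall xi, Sigma xi -> phi_bounded M rho xiphi xi)
  (hscalar : asymptotically_scalar rho J phi N Sigma) :
  (exists (p : K -> K) (S : {fset L}) (kappa : R),
     corner_gap rho J phi N Sigma p S kappa) /\
  (forall eps : R, 0 < eps ->
     exists (p : K -> K) (S : {fset L}) (kappa : R),
       corner_gap rho J phi N Sigma p S kappa /\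
       phi (idfun - p) < eps%:C).
Proof.
suff main : forall eps : R, 0 < eps ->
    exists (p : K -> K) (S : {fset L}) (kappa : R),
      corner_gap rho J phi N Sigma p S kappa /\ phi (idfun - p) < eps%:C.
  split=> //; have [p [S [kappa [gap _]]]] := main 1 ltr01.
  by exists p, S, kappa.
move=> eps1 eps1_gt0; apply: contrapT => hno.
pose eps : R := Num.min eps1 2^-1.
have eps0 : 0 < eps by rewrite lt_min eps1_gt0 invr_gt0 ltr0n.
have eps_le : eps <= eps1 by rewrite ge_min lexx.
have eps_half : eps <= 2^-1 by rewrite ge_min lexx orbT.
clearbody eps.
have JSigma xi : Sigma xi -> Sigma (J xi).
  by move=> Sxi; rewrite -hJSigma; exists xi.
have JJ := JK hL.
have nogap (S : {fset L}) : [set` S] `<=` Sigma ->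
    (forall xi, xi \in S -> J xi \in S) ->
    forall p (theta : R), N p -> is_projection p ->
    mass rho xiphi (idfun - p) < eps -> 0 < theta ->
    exists h, [/\ N h, is_adjoint h h, p \o h = h, ip (rho h xiphi) xiphi = 0 &
      corner_energy rho J S p h < theta * mass rho xiphi h].
  move=> SS SJ p theta Np hp mp t0; apply: contrapT => nh.
  have Mp := hNM _ Np; have Mi := vna_id hM.
  have p0 : p <> 0.
    move=> p0; move: mp; rewrite p0 subr0 (mass_id hM hphi hL hxiphi).
    by lra.
  have [|kappa gap] :=
    gap_of_self_adjoint hM hL hxiphi hN hNM Np hp SJ t0 _ p0 SS.
    move=> h Nh ah ph h0; rewrite leNgt; apply/negP => hlt.
    by apply: nh; exists h.
  apply: hno; exists p, S, kappa; split=> //.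
  have cp : is_projection (idfun - p).
    by apply: (proj_compl _ hp); exact: (vna_linear hM Mp).
  rewrite (state_projection hM hL hxiphi (vnaB hM Mi Mp) cp) ltcR.
  exact: lt_le_trans mp eps_le.
(* S is intersected with Sigma to index the net by all finite sets, and then
   made stable under J *)
have /choice[x hx] : forall i : {fset L} * nat, exists q, [/\ N q, is_projection q,
    forall xi, xi \in i.1 -> Sigma xi -> sqn (commutator rho J q xi) <= i.2.+1%:R^-1,
    eps <= mass rho xiphi q & mass rho xiphi q <= (1 + eps) / 2].
  move=> [S n] /=.
  pose S1 : {fset L} := [fset xi in S | `[< Sigma xi >]]%fset.
  pose S2 : {fset L} := (S1 `|` [fset J xi | xi in S1])%fset.
  have S1P xi : xi \in S1 -> Sigma xi.
    by rewrite !inE /= => /andP[_ /asboolP].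
  have S2P xi : xi \in S2 -> Sigma xi.
    rewrite in_fsetU => /orP[/S1P //|/imfsetP[/= u /S1P Su ->]].
    exact: JSigma.
  have S2J xi : xi \in S2 -> J xi \in S2.
    rewrite !in_fsetU => /orP[xiS|/imfsetP[/= u uS ->]].
      by apply/orP; right; apply/imfsetP; exists xi.
    by rewrite JJ uS.
  have [|b b0 hb] := bounded_vectors hL hxiphi (S := S2).
    by move=> xi /S2P Sxi; split; apply: hbSigma => //; exact: JSigma.
  have d0 : 0 < n.+1%:R^-1 :> R by rewrite invr_gt0 ltr0n.
  have eps_lt1 : eps < 1 by lra.
  have [q [Nq hq Eq q1 q2]] := small_commutator_projection hM hphi hL hxiphi
    hN hNM b0 hb eps0 eps_lt1 d0 (nogap S2 S2P S2J).
  exists q; split=> // xi xiS Sxi; apply: le_trans Eq.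
  have xiS2 : xi \in S2.
    by rewrite in_fsetU; apply/orP; left; rewrite !inE /= xiS; apply/asboolP.
  have Mq := hNM _ Nq.
  rewrite /corner_energy (big_rem xi)//= (commutator_sa _ _ _ hq.2).
  rewrite (rr_id hM hL) (rho_id hM hL) lerDl.
  by apply: sumr_ge0 => u _; exact: sqn_ge0.
pose le (i j : {fset L} * nat) := (i.1 `<=` j.1)%fset && (i.2 <= j.2)%N.
have Nx i : N (x i) by case: (hx i).
have hpx i : is_projection (x i) by case: (hx i).
have Mx i : M (x i) by exact: hNM.
have le_directed : directed (fun i j => le i j).
  split; first exact: (inhabits (fset0, 0%N)).
  - by move=> i; rewrite /le fsubset_refl leqnn.
  - move=> j i k /andP[ij1 ij2] /andP[jk1 jk2].
    by rewrite /le (fsubset_trans ij1 jk1) (leq_trans ij2 jk2).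
  - move=> i j; exists ((i.1 `|` j.1)%fset, maxn i.2 j.2).
      by rewrite /le /= fsubsetUl leq_maxl.
    by rewrite /le /= fsubsetUr leq_maxr.
have x_bounded : bounded_net x.
  exists 1 => i u; rewrite norm_real (norm_real u) -rmorphM mul1r lecR.
  exact: nr_le (proj_sqn_le (hpx i) u).
have x_commutes xi : Sigma xi ->
    (fun i => `|commutator rho J (x i) xi|) @ tails (fun i j => le i j)
      --> (0 : R[i]^o).
  move=> Sxi A /nbhs_ballP[e /= e0 he].
  have er : e = (complex.Re e)%:C by rewrite RRe_real// gtr0_real.
  have e'0 : 0 < complex.Re e by move: e0; rewrite er ltcR.
  have q0 : 0 <= (complex.Re e ^+ 2)^-1 by rewrite invr_ge0 sqr_ge0.
  pose n := Num.bound (complex.Re e ^+ 2)^-1.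
  exists ([fset xi]%fset, n) => j /andP[/= xij nj]; apply: he.
  rewrite -ball_normE /ball_ /= sub0r normrN normr_id norm_real er ltcR.
  rewrite -(@ltr_pXn2r _ 2)// ?nnegrE ?Re_norm_ge0 ?(ltW e'0)// -sqnE.
  have [_ _ small _ _] := hx j.
  apply: le_lt_trans (small xi _ Sxi) _; first by rewrite -fsub1set.
  rewrite invf_plt ?posrE ?ltr0n ?exprn_gt0//.
  apply: lt_le_trans (archi_boundP q0) _.
  by rewrite ler_nat ltnW// ltnS.
have lim := hscalar _ _ x le_directed Nx x_bounded x_commutes.
(* phi(x)(1 - phi(x)) >= eps/4 > (eps/4)^2 because eps <= 1/2 *)
have e4 : 0 < eps / 4 by rewrite divr_gt0.
have := lim (ball (0 : R[i]^o) (eps / 4)%:C) (nbhsx_ballx _ _ _).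
rewrite ltcR => /(_ e4)[i hi].
have [_ hxi _ m1 m2] := hx i.
have Mi := vna_id hM.
have := hi i; rewrite /le /= fsubset_refl leqnn => /(_ isT).
rewrite -ball_normE /ball_ /= sub0r normrN.
rewrite (state_projection hM hL hxiphi (Mx i) hxi).
set m := mass rho xiphi (x i) in m1 m2 *.
have Mm : M (m%:C *: idfun) by exact: (vnaZ hM).
rewrite (state_normE hM hL hxiphi (vnaB hM (Mx i) Mm)) normr_id norm_real ltcR.
rewrite -(@ltr_pXn2r _ 2)// ?nnegrE ?Re_norm_ge0 ?(ltW e4)// -sqnE.
rewrite (rhoB hM hL)// (rhoZ hM hL)// (rho_id hM hL) sqnB ipZr sqnZ.
rewrite (proj_ip (rho_projection hL (Mx i) hxi)) -/(mass rho xiphi (x i)) -/m.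
have -> : sqn xiphi = 1.
  by have := mass_id hM hphi hL hxiphi; rewrite /mass (rho_id hM hL).
by nra.
Qed.
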